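(* For general Kundt metrics in dimension $n=3$, the derivations $$\nabla_1=\frac{W_v}{W_{vv}}\mathcal{D}_v,\qquad \nabla_2=\frac{2}{W_v}\mathcal{D}_x+\frac{h_xW_v-2hW_{xv}}{hW_vW_{vv}}\mathcal{D}_v,$$ $$\nabla_3=\frac{1}{W_v}\left(H_{vv}\mathcal{D}_x-W_{vv}\mathcal{D}_u+(W_{uv}-H_{xv})\mathcal{D}_v\right)$$ are invariant with respect to $\mathcal{G}$, and they are independent on a Zariski open subset of $\mathcal{E}^2$.
   Context: Three-dimensional Kundt metrics in adapted coordinates $(u,x,v)$ are $g=du\,(dv+H\,du+W\,dx)+h\,dx^2$ with $H,W$ functions of $(u,x,v)$ and $h=h(u,x)>0$. Let $\pi$ be the trivial bundle over $M=\mathbb{R}^3(u,x,v)$ with fiber coordinates $H,W,h$ ($h>0$). $\mathcal{E}^0=J^0\pi$, and for $k\ge1$ $\mathcal{E}^k\subset J^k\pi$ is given by $h_v=0$ and its total derivatives of order $\le k$; $\mathcal{E}^\infty$ is the infinite prolongation. $\mathcal{G}$ is the Lie pseudogroup of local diffeomorphisms $(u,x,v)\mapsto(C(u),A(u,x),v/C'(u)+B(u,x))$ with $A_x\neq0$, $C'\ne0$; it acts on Kundt metrics of the form $g=du\,(dv+H\,du+W\,dx)+h\,dx^2$, hence on $J^0\pi$ (so that $g$, viewed as a horizontal symmetric 2-form on $\pi$, is invariant), and the action prolongs to jets preserving $\mathcal{E}^k$. $\mathcal{D}_u,\mathcal{D}_x,\mathcal{D}_v$ are the total derivatives (restricted to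 $\mathcal{E}^\infty$). An invariant derivation is a horizontal vector field $a\mathcal{D}_u+b\mathcal{D}_x+c\mathcal{D}_v$, with $a,b,c$ functions on some $\mathcal{E}^r$, that is invariant under the prolonged action of $\mathcal{G}$. ''Zariski open'' means nonempty Zariski open (in the fibers over $J^0\pi$). *)

(* Defs.v *)
From Stdlib Require Import Reals List Factorial.
From Coquelicot Require Import Coquelicot.
Open Scope R_scope.

Notation point := (R * R * R)%type.

Inductive ivar := iu | ix | iv.

Definition crd (i : ivar) (p : point) : R :=
  match i with iu => fst (fst p) | ix => snd (fst p) | iv => snd p end.

Definition set_crd (i : ivar) (p : point) (t : R) : point :=
  match i with
  | iu => (t, crd ix p, crd iv p)
  | ix => (crd iu p, t, crd iv p)
  | iv => (crd iu p, crd ix p, t)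
  end.

Definition pd (i : ivar) (f : point -> R) (p : point) : R :=
  Derive (fun t => f (set_crd i p t)) (crd i p).

Definition ex_pd (i : ivar) (f : point -> R) (p : point) : Prop :=
  ex_derive (fun t => f (set_crd i p t)) (crd i p).

Fixpoint Cn_on (n : nat) (U : point -> Prop) (f : point -> R) : Prop :=
  (forall p, U p -> continuous f p) /\
  match n with
  | O => True
  | S m => forall i, (forall p, U p -> ex_pd i f p) /\ Cn_on m U (pd i f)
  end.

Definition smooth_on (U : point -> Prop) (f : point -> R) : Prop :=
  forall n, Cn_on n U f.

(* The multi-index of d_u^mu d_x^mx d_v^mv. *)
Record multi := Mi { mu : nat; mx : nat; mv : nat }.

Definition msize (s : multi) : nat := (mu s + mx s + mv s)%nat.

Definition incr (i : ivar) (s : multi) : multi :=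
  match i with
  | iu => Mi (S (mu s)) (mx s) (mv s)
  | ix => Mi (mu s) (S (mx s)) (mv s)
  | iv => Mi (mu s) (mx s) (S (mv s))
  end.

Definition pds (s : multi) (f : point -> R) : point -> R :=
  Nat.iter (mu s) (pd iu) (Nat.iter (mx s) (pd ix) (Nat.iter (mv s) (pd iv) f)).

(* Each multi-index of size at most k, once. *)
Definition multis (k : nat) : list multi :=
  flat_map (fun a =>
    flat_map (fun b =>
      map (fun c => Mi a b c) (seq 0 (S (k - a - b))))
      (seq 0 (S (k - a))))
    (seq 0 (S k)).

Inductive dvar := dH | dW | dh.

(* The condition h > 0 is imposed on jets (see [in_E]), not on this type. *)
Definition section := dvar -> point -> R.

Inductive jcoord :=
  | base (i : ivar)
  | fib (a : dvar) (s : multi).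

Definition corder (c : jcoord) : nat :=
  match c with base _ => O | fib _ s => msize s end.

(* A point of J^oo is the family of its standard coordinates.  A point of J^k
   is such a family up to [agree k]; functions on and subsets of J^k are those
   of J^oo that respect [agree k]. *)
Definition jet := jcoord -> R.

Definition agree (k : nat) (th th' : jet) : Prop :=
  forall c, (corder c <= k)%nat -> th c = th' c.

Definition jpoint (th : jet) : point := (th (base iu), th (base ix), th (base iv)).

Definition jet_of (s : section) (p : point) : jet :=
  fun c => match c with
           | base i => crd i p
           | fib a m => pds m (s a) p
           end.

(* h > 0, together with h_v = 0 and those of its total derivatives that have
   order at most k as functions on the jet space. *)
Definition in_E (k : nat) (th : jet) : Prop :=
  0 < th (fib dh (Mi 0 0 0)) /\
  forall m, (msize (incr iv m) <= k)%nat -> th (fib dh (incr iv m)) = 0.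

Definition in_Einf (th : jet) : Prop := forall k, in_E k th.

Definition monomial (p : point) (m : multi) (q : point) : R :=
  (crd iu q - crd iu p) ^ mu m / INR (fact (mu m)) *
  ((crd ix q - crd ix p) ^ mx m / INR (fact (mx m))) *
  ((crd iv q - crd iv p) ^ mv m / INR (fact (mv m))).

(* A section whose k-jet at the base point of [th] is the k-jet of [th]. *)
Definition taylor (k : nat) (th : jet) : section :=
  fun a q => fold_right Rplus 0
    (map (fun m => th (fib a m) * monomial (jpoint th) m q) (multis k)).

Definition diffeo (U V : point -> Prop) (phi psi : point -> point) : Prop :=
  open U /\ open V /\
  (forall p, U p -> V (phi p) /\ psi (phi p) = p) /\
  (forall q, V q -> U (psi q) /\ phi (psi q) = q) /\
  (forall i, smooth_on U (fun p => crd i (phi p))) /\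
  (forall i, smooth_on V (fun q => crd i (psi q))).

(* [phi] is an element of G with domain [U], image [V] and inverse [psi].
   Smoothness of C, A and B where they are used follows from that of [phi]. *)
Definition in_G (U V : point -> Prop) (phi psi : point -> point) : Prop :=
  diffeo U V phi psi /\
  exists (C : R -> R) (A B : R -> R -> R),
    forall u x v, U (u, x, v) ->
      phi (u, x, v) = (C u, A u x, v / Derive C u + B u x) /\
      Derive C u <> 0 /\ Derive (fun y => A u y) x <> 0.

(* The quadratic form X |-> g(X,X) at p, for
   g = du (dv + H du + W dx) + h dx^2. *)
Definition metric (s : section) (p X : point) : R :=
  crd iu X * (crd iv X + s dH p * crd iu X + s dW p * crd ix X)
  + s dh p * (crd ix X) ^ 2.

Definition tangent_map (f : point -> point) (p X : point) : point :=
  let d i := pd iu (fun q => crd i (f q)) p * crd iu X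
           + pd ix (fun q => crd i (f q)) p * crd ix X
           + pd iv (fun q => crd i (f q)) p * crd iv X in
  (d iu, d ix, d iv).

Definition pullback_metric (f : point -> point) (s : section) (q Y : point) : R :=
  metric s (f q) (tangent_map f q Y).

(* The image of the section under phi in G, where psi is the inverse of phi:
   psi^* g is again of the form du (dv + H' du + W' dx) + h' dx^2, and H', W', h'
   are read off as its coefficients of du^2, du dx, dx^2. *)
Definition push (psi : point -> point) (s : section) : section :=
  fun a q =>
    let g := pullback_metric psi s q in
    match a with
    | dH => g (1, 0, 0)
    | dW => g (1, 1, 0) - g (1, 0, 0) - g (0, 1, 0)
    | dh => g (0, 1, 0)
    end.

(* The prolonged action j_p^k s |-> j_{phi(p)}^k (phi_* s).  It does not depend
   on the representative s; each coordinate is computed with the Taylor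
   polynomial of the order of this coordinate. *)
Definition prolong (phi psi : point -> point) (th : jet) : jet :=
  fun c => jet_of (push psi (taylor (corder c) th)) (phi (jpoint th)) c.

(* The components of the vector field
   D_i = d/dx^i + sum over alpha, sigma of y^alpha_(sigma+i) d/dy^alpha_sigma
   on J^oo; it is tangent to E^oo. *)
Definition total_derivative (i : ivar) (th : jet) : jcoord -> R :=
  fun c => match c, i with
           | base iu, iu | base ix, ix | base iv, iv => 1
           | base _, _ => 0
           | fib a m, _ => th (fib a (incr i m))
           end.

(* a D_u + b D_x + c D_v, with coefficients defined on [hdom]. *)
Record hfield := HField {
  hdom : jet -> Prop;
  hcoef : ivar -> jet -> R
}.

Definition hvect (N : hfield) (th : jet) : jcoord -> R :=
  fun c => hcoef N iu th * total_derivative iu th c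
         + hcoef N ix th * total_derivative ix th c
         + hcoef N iv th * total_derivative iv th c.

Definition on_jets_of_order (r : nat) (N : hfield) : Prop :=
  forall th th', agree r th th' ->
    (hdom N th <-> hdom N th') /\ forall i, hcoef N i th = hcoef N i th'.

(* Phi_* N = N for the prolongation Phi of every element of G: the domain is
   invariant, and dPhi maps N(th) to N(Phi(th)), in every jet coordinate c. *)
Definition invariant_derivation (N : hfield) : Prop :=
  (exists r, on_jets_of_order r N) /\
  forall U V phi psi, in_G U V phi psi ->
  forall th, in_Einf th -> U (jpoint th) -> hdom N th ->
    hdom N (prolong phi psi th) /\
    forall c, is_derive
      (fun t => prolong phi psi (fun c' => th c' + t * hvect N th c') c) 0
      (hvect N (prolong phi psi th) c).

Definition independent_at (N1 N2 N3 : hfield) (th : jet) : Prop :=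
  forall l1 l2 l3 : R,
    (forall c, l1 * hvect N1 th c + l2 * hvect N2 th c + l3 * hvect N3 th c = 0) ->
    l1 = 0 /\ l2 = 0 /\ l3 = 0.

(* Polynomial functions on the fibers of J^k over J^0. *)
Inductive fiber_polynomial (k : nat) : (jet -> R) -> Prop :=
  | fp_const r : fiber_polynomial k (fun _ => r)
  | fp_coord a m : (1 <= msize m <= k)%nat ->
      fiber_polynomial k (fun th => th (fib a m))
  | fp_add P Q : fiber_polynomial k P -> fiber_polynomial k Q ->
      fiber_polynomial k (fun th => P th + Q th)
  | fp_mul P Q : fiber_polynomial k P -> fiber_polynomial k Q ->
      fiber_polynomial k (fun th => P th * Q th).

(* [Om] is a subset of E^k whose intersection with the fiber of E^k over each
   point [th0] of J^0 is Zariski open and nonempty. *)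
Definition zariski_open (k : nat) (Om : jet -> Prop) : Prop :=
  (forall th, Om th -> in_E k th) /\
  forall th0 : jet, 0 < th0 (fib dh (Mi 0 0 0)) ->
    (exists th, agree 0 th0 th /\ Om th) /\
    exists S : (jet -> R) -> Prop,
      (forall P, S P -> fiber_polynomial k P) /\
      forall th, agree 0 th0 th ->
        (Om th <-> in_E k th /\ exists P, S P /\ P th <> 0).

Definition h_ (th : jet) : R := th (fib dh (Mi 0 0 0)).
Definition h_x (th : jet) : R := th (fib dh (Mi 0 1 0)).
Definition W_v (th : jet) : R := th (fib dW (Mi 0 0 1)).
Definition W_vv (th : jet) : R := th (fib dW (Mi 0 0 2)).
Definition W_xv (th : jet) : R := th (fib dW (Mi 0 1 1)).
Definition W_uv (th : jet) : R := th (fib dW (Mi 1 0 1)).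
Definition H_vv (th : jet) : R := th (fib dH (Mi 0 0 2)).
Definition H_xv (th : jet) : R := th (fib dH (Mi 0 1 1)).

Definition nabla1 : hfield :=
  {| hdom th := W_vv th <> 0;
     hcoef i th :=
       match i with
       | iu => 0
       | ix => 0
       | iv => W_v th / W_vv th
       end |}.

Definition nabla2 : hfield :=
  {| hdom th := W_v th <> 0 /\ W_vv th <> 0;
     hcoef i th :=
       match i with
       | iu => 0
       | ix => 2 / W_v th
       | iv => (h_x th * W_v th - 2 * h_ th * W_xv th)
               / (h_ th * W_v th * W_vv th)
       end |}.

Definition nabla3 : hfield :=
  {| hdom th := W_v th <> 0;
     hcoef i th :=
       match i with
       | iu => 1 / W_v th * - W_vv th
       | ix => 1 / W_v th * H_vv th
       | iv => 1 / W_v th * (W_uv th - H_xv th)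
       end |}.

(* Main.v *)
Require Import Defs.
From Stdlib Require Import Reals List Factorial Lra Lia FunctionalExtensionality.
From Coquelicot Require Import Coquelicot.
Open Scope R_scope.

(** Let [phi] be a diffeomorphism with inverse [psi].  By induction on the
    multi-index, every jet coordinate of the transformed section at [phi p] is
    affine in the fiber coordinates of the jet at [p], with smooth coefficients
    on the image of [phi], and raising the multi-index amounts to taking a total
    derivative.  The derivative of such an affine form along a line with
    velocity [sum_i b_i D_i] is the combination of its total derivatives with
    coefficients [Dphi b].  Hence the prolongation of [phi] maps [sum_i b_i D_i]
    to [sum_j (Dphi b)_j D_j] in every jet coordinate, and invariance of a
    horizontal field amounts to [Dpsi N' = N] for its coefficients at a jet ([N])
    and at the transformed jet ([N']).

    For [psi] in the pseudogroup, with [c = d_u psi^u], [a = d_x psi^x] and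
    [w = d_u psi^x], the Jacobian satisfies [d_x psi^u = d_v psi^u = d_v psi^x = 0]
    and [d_v psi^v = 1/c], and modulo [h_v = 0] this gives
    [W'_v = a W_v], [W'_vv = (a/c) W_vv], [H'_vv = H_vv + (w/c) W_vv], and so on;
    the identities [Dpsi N' = N] are then algebraic.  On the set where [W_v] and
    [W_vv] do not vanish, the coefficients of the three fields form an
    anti-triangular matrix with nonzero anti-diagonal. *)

(** * Partial derivatives *)

(** The pointwise estimate replaces the filter formulation of differentiability, so that the chain
    rule below can be proved with absolute values alone. *)
Lemma is_derive_eps (f : R -> R) (x l : R) :
  is_derive f x l <->
  forall eps, 0 < eps ->
    locally x (fun y => Rabs (f y - f x - l * (y - x)) <= eps * Rabs (y - x)).
Proof.
  split.
  - intros [_ H] eps He.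
    specialize (H x (fun P HP => HP) (mkposreal eps He)).
    revert H; apply filter_imp; intros y; simpl.
    unfold norm, minus, plus, opp, scal; simpl; unfold abs, mult; simpl.
    intros H; replace (f y - f x - l * (y - x)) with (f y + - f x + - ((y + - x) * l)) by ring.
    exact H.
  - intros H; split; [apply is_linear_scal_l|].
    intros x' Hx' eps.
    apply (is_filter_lim_locally_unique (K := R_AbsRing) (V := R_NormedModule)) in Hx'; subst x'.
    generalize (H eps (cond_pos eps)); apply filter_imp; intros y; simpl.
    unfold norm, minus, plus, opp, scal; simpl; unfold abs, mult; simpl.
    intros H1; replace (f y + - f x + - ((y + - x) * l)) with (f y - f x - l * (y - x)) by ring.
    exact H1.
Qed.

(** Relational form of [pd]: [Derive] is total, so a value of [pd] by itself does not witness
    differentiability. *)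
Definition is_pd (i : ivar) (f : point -> R) (p : point) (l : R) : Prop :=
  is_derive (fun t => f (set_crd i p t)) (crd i p) l.

Lemma crd_eta (p : point) : (crd iu p, crd ix p, crd iv p) = p.
Proof. destruct p as [[u x] v]; reflexivity. Qed.

Lemma set_crd_same i p : set_crd i p (crd i p) = p.
Proof. destruct p as [[u x] v]; destruct i; reflexivity. Qed.

Lemma crd_set_same i p t : crd i (set_crd i p t) = t.
Proof. destruct i; reflexivity. Qed.

Lemma set_set_same i p t t' : set_crd i (set_crd i p t) t' = set_crd i p t'.
Proof. destruct i; reflexivity. Qed.

Lemma ball_point (p q : point) (e : R) :
  ball p e q <-> forall i, Rabs (crd i q - crd i p) < e.
Proof.
  destruct p as [[u x] v], q as [[u' x'] v']; split.
  - intros [[H1 H2] H3] i; destruct i; assumption.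
  - intros H; repeat split; [apply (H iu)|apply (H ix)|apply (H iv)].
Qed.

Lemma locally_set_crd i p (P : point -> Prop) :
  locally p P -> locally (crd i p) (fun t => P (set_crd i p t)).
Proof.
  intros [e H]; exists e; intros t Ht; apply H.
  destruct p as [[u x] v]; destruct i; repeat split; simpl;
    first [apply Ht | apply ball_center].
Qed.

Lemma is_pd_unique i f p l : is_pd i f p l -> pd i f p = l.
Proof. apply is_derive_unique. Qed.

Lemma pd_correct i f p : ex_pd i f p -> is_pd i f p (pd i f p).
Proof. apply Derive_correct. Qed.

Lemma is_pd_ex i f p l : is_pd i f p l -> ex_pd i f p.
Proof. intros H; exists l; exact H. Qed.

Lemma is_pd_ext_loc i f g p l :
  locally p (fun q => f q = g q) -> is_pd i f p l -> is_pd i g p l.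
Proof.
  intros H; apply is_derive_ext_loc.
  apply (locally_set_crd i p (fun q => f q = g q)), H.
Qed.

Lemma pd_ext_loc i f g p :
  locally p (fun q => f q = g q) -> pd i f p = pd i g p.
Proof.
  intros H; apply Derive_ext_loc.
  apply (locally_set_crd i p (fun q => f q = g q)), H.
Qed.

Lemma is_pd_const i c p : is_pd i (fun _ => c) p 0.
Proof. exact (is_derive_const (V := R_NormedModule) c (crd i p)). Qed.

Lemma is_pd_plus i f g p l1 l2 :
  is_pd i f p l1 -> is_pd i g p l2 -> is_pd i (fun q => f q + g q) p (l1 + l2).
Proof. exact (is_derive_plus (V := R_NormedModule) _ _ _ _ _). Qed.

Lemma is_pd_mult i f g p l1 l2 :
  is_pd i f p l1 -> is_pd i g p l2 ->
  is_pd i (fun q => f q * g q) p (l1 * g p + f p * l2).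
Proof.
  intros H1 H2.
  generalize (is_derive_mult _ _ _ _ _ H1 H2 Rmult_comm); cbv beta.
  rewrite set_crd_same; exact (fun H => H).
Qed.

Definition delta (i j : ivar) : R :=
  match i, j with iu, iu | ix, ix | iv, iv => 1 | _, _ => 0 end.

Lemma is_pd_crd i j p : is_pd i (crd j) p (delta i j).
Proof.
  destruct i, j; unfold is_pd; simpl;
    first [apply @is_derive_id | apply (is_derive_const (V := R_NormedModule))].
Qed.

(** * Functions of class C^n on an open set *)

Lemma open_locally (U : point -> Prop) (P : point -> Prop) p :
  open U -> U p -> (forall q, U q -> P q) -> locally p P.
Proof. intros HU Hp H; generalize (HU p Hp); apply filter_imp, H. Qed.

Lemma Cn_on_continuous n (U : point -> Prop) f (p : point) : Cn_on n U f -> U p -> continuous f p.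
Proof. destruct n; intros [H _]; apply H. Qed.

(** Openness turns equality on [U] into equality near each point, which the partial derivatives
    inherit. *)
Lemma Cn_on_ext n (U : point -> Prop) (f g : point -> R) :
  open U -> (forall p, U p -> f p = g p) -> Cn_on n U f -> Cn_on n U g.
Proof.
  intros HU; revert f g; induction n as [|n IH]; intros f g E [Hc H].
  1,2: split; [intros p Hp; apply (continuous_ext_loc g f p);
         [apply (open_locally U); auto | auto]|].
  - exact I.
  - intros i; destruct (H i) as [H1 H2]; split.
    + intros p Hp.
      apply (is_pd_ex i g p (pd i f p)), (is_pd_ext_loc i f).
      * apply (open_locally U); auto.
      * apply pd_correct, H1, Hp.
    + apply (IH (pd i f)), H2; intros p Hp.
      apply pd_ext_loc, (open_locally U); auto.
Qed.

Lemma Cn_on_le n m U f : (m <= n)%nat -> Cn_on n U f -> Cn_on m U f.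
Proof.
  revert m f; induction n as [|n IH]; intros m f Hm H.
  - replace m with O by lia; exact H.
  - destruct m as [|m]; (split; [apply H|]); [exact I|].
    intros i; split; [|apply IH; [lia|]]; apply H.
Qed.

Lemma Cn_on_const n U c : Cn_on n U (fun _ => c).
Proof.
  revert c; induction n as [|n IH]; intros c;
    (split; [intros; apply continuous_const|]); [exact I|].
  intros i; split.
  - intros p _; exact (is_pd_ex _ _ _ _ (is_pd_const i c p)).
  - replace (pd i (fun _ => c)) with (fun _ : point => 0); [apply IH|].
    extensionality p; symmetry; apply is_pd_unique, is_pd_const.
Qed.

Lemma continuous_crd i (p : point) : continuous (crd i) p.
Proof.
  destruct i; [apply (continuous_comp fst fst)|apply (continuous_comp fst snd)|];
    first [apply continuous_fst | apply continuous_snd].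
Qed.

Lemma smooth_on_crd U i : smooth_on U (crd i).
Proof.
  intros [|n]; (split; [intros; apply continuous_crd|]); [exact I|].
  intros j; split.
  - intros p _; exact (is_pd_ex _ _ _ _ (is_pd_crd j i p)).
  - replace (pd j (crd i)) with (fun _ : point => delta j i); [apply Cn_on_const|].
    extensionality p; symmetry; apply is_pd_unique, is_pd_crd.
Qed.

Lemma Cn_on_plus n (U : point -> Prop) f g :
  open U -> Cn_on n U f -> Cn_on n U g -> Cn_on n U (fun q => f q + g q).
Proof.
  intros HU; revert f g; induction n as [|n IH]; intros f g Hf Hg.
  1,2: split; [intros p Hp; apply @continuous_plus; [apply Hf|apply Hg]; exact Hp|].
  - exact I.
  - intros i.
    assert (E : forall p, U p -> is_pd i (fun q => f q + g q) p (pd i f p + pd i g p)).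
    { intros p Hp; apply is_pd_plus; apply pd_correct; [apply Hf|apply Hg]; exact Hp. }
    split; [intros p Hp; exact (is_pd_ex _ _ _ _ (E p Hp))|].
    apply (Cn_on_ext n U (fun q => pd i f q + pd i g q) _ HU).
    + intros p Hp; symmetry; apply is_pd_unique, E, Hp.
    + apply IH; [apply Hf|apply Hg].
Qed.

Lemma Cn_on_mult n (U : point -> Prop) f g :
  open U -> Cn_on n U f -> Cn_on n U g -> Cn_on n U (fun q => f q * g q).
Proof.
  intros HU; revert f g; induction n as [|n IH]; intros f g Hf Hg.
  1,2: split; [intros p Hp; apply (continuous_mult f g); [apply Hf|apply Hg]; exact Hp|].
  - exact I.
  - intros i.
    assert (E : forall p, U p ->
      is_pd i (fun q => f q * g q) p (pd i f p * g p + f p * pd i g p)).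
    { intros p Hp; apply is_pd_mult; apply pd_correct; [apply Hf|apply Hg]; exact Hp. }
    split; [intros p Hp; exact (is_pd_ex _ _ _ _ (E p Hp))|].
    apply (Cn_on_ext n U (fun q => pd i f q * g q + f q * pd i g q) _ HU).
    + intros p Hp; symmetry; apply is_pd_unique, E, Hp.
    (* The Leibniz rule also uses [f] and [g] themselves at the lower order, whence [Cn_on_le]. *)
    + apply Cn_on_plus; [exact HU|apply IH..];
        try apply Hf; try apply Hg; apply (Cn_on_le (S n)); auto.
Qed.

Lemma smooth_on_pd U i f : smooth_on U f -> smooth_on U (pd i f).
Proof. intros H n; apply (H (S n)). Qed.

Lemma smooth_on_is_pd U i f p : smooth_on U f -> U p -> is_pd i f p (pd i f p).
Proof. intros H Hp; apply pd_correct, (H 1%nat), Hp. Qed.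

(** * The chain rule along a curve *)

Lemma partial_increment i f (U : point -> Prop) p eps :
  open U -> Cn_on 1 U f -> U p -> 0 < eps ->
  locally p (fun q =>
    Rabs (f q - f (set_crd i q (crd i p)) - pd i f p * (crd i q - crd i p))
      <= eps * Rabs (crd i q - crd i p)).
Proof.
  intros HU [_ Hf] Hp He.
  destruct (Hf i) as [Hex [Hc _]].
  assert (H := filter_and _ _ (HU p Hp)
    (proj1 (filterlim_locally _ _) (Hc p Hp) (mkposreal eps He))).
  destruct H as [d Hd]; exists d; intros q Hq.
  (* Balls of the product are boxes, so the segment from [q] in direction [i] to the level of [p]
     stays in the ball where the partial derivative is within [eps] of its value at [p]. *)
  assert (Hin : forall t, Rmin (crd i p) (crd i q) <= t <= Rmax (crd i p) (crd i q) ->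
            U (set_crd i q t) /\ Rabs (pd i f (set_crd i q t) - pd i f p) < eps).
  { intros t Ht; apply Hd; apply ball_point; intros j.
    rewrite ball_point in Hq.
    assert (Hi := Hq i); assert (Hj := Hq j).
    assert (E : crd j (set_crd i q t) = crd j q \/
                i = j /\ crd j (set_crd i q t) = t) by (destruct i, j; auto).
    destruct E as [E|[E1 E]]; rewrite E; [exact Hj|subst j].
    revert Ht Hi; unfold Rmin, Rmax, Rabs.
    destruct (Rle_dec (crd i p) (crd i q)); repeat destruct Rcase_abs; lra. }
  (* The mean value theorem on this segment gives an estimate uniform in the other coordinates of
     [q], which may move as well. *)
  destruct (MVT_gen (fun t => f (set_crd i q t)) (crd i p) (crd i q)
     (fun t => pd i f (set_crd i q t))) as [c [Hc1 Hc2]].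
  - intros t Ht.
    assert (Ht' : is_pd i f (set_crd i q t) (pd i f (set_crd i q t)))
      by (apply pd_correct, Hex, Hin; lra).
    unfold is_pd in Ht'; rewrite crd_set_same in Ht'.
    eapply is_derive_ext, Ht'; intros s; cbv beta; now rewrite set_set_same.
  - intros t Ht; apply continuity_pt_filterlim, (ex_derive_continuous (V := R_NormedModule)).
    assert (Ht' : is_pd i f (set_crd i q t) (pd i f (set_crd i q t)))
      by (apply pd_correct, Hex, Hin; lra).
    exists (pd i f (set_crd i q t)).
    unfold is_pd in Ht'; rewrite crd_set_same in Ht'.
    eapply is_derive_ext, Ht'; intros s; cbv beta; now rewrite set_set_same.
  - cbv beta in Hc2; rewrite set_crd_same in Hc2; rewrite Hc2.
    replace (pd i f (set_crd i q c) * (crd i q - crd i p) - pd i f p * (crd i q - crd i p))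
      with ((pd i f (set_crd i q c) - pd i f p) * (crd i q - crd i p)) by ring.
    rewrite Rabs_mult; apply Rmult_le_compat_r; [apply Rabs_pos|].
    left; apply Hin, Hc1.
Qed.

(** Composes two first-order estimates: [k] is [P] times the increment of [g] up to a small multiple
    of that increment, and the increment of [g] is itself of first order in [t - t0]. *)
Lemma is_derive_along_increment (k g : R -> R) t0 P l :
  is_derive g t0 l ->
  (forall eps, 0 < eps ->
    locally t0 (fun t => Rabs (k t - P * (g t - g t0)) <= eps * Rabs (g t - g t0))) ->
  is_derive k t0 (P * l).
Proof.
  intros Hg Hk; apply is_derive_eps; intros eps He.
  (* At [t = t0] the estimate bounds the absolute value of [k t0] by zero. *)
  assert (Hk0 : k t0 = 0).
  { assert (H := locally_singleton _ _ (Hk 1 Rlt_0_1)); cbv beta in H.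
    replace (g t0 - g t0) with 0 in H by ring.
    rewrite Rabs_R0, !Rmult_0_r, Rminus_0_r in H.
    revert H; unfold Rabs; destruct Rcase_abs; lra. }
  assert (HP := Rabs_pos P); assert (Hl := Rabs_pos l).
  (* Each of the two error terms receives half of [eps]; the added 1 keeps the denominators positive
     when [P] or [l] vanishes. *)
  set (e1 := eps / 2 / (Rabs P + 1)).
  set (e2 := eps / 2 / (Rabs l + 1)).
  assert (He1 : 0 < e1) by (unfold e1; repeat apply Rdiv_lt_0_compat; lra).
  assert (He2 : 0 < e2) by (unfold e2; repeat apply Rdiv_lt_0_compat; lra).
  assert (E1 : (Rabs P + 1) * e1 = eps / 2) by (unfold e1; field; lra).
  assert (E2 : e2 * (Rabs l + 1) = eps / 2) by (unfold e2; field; lra).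
  generalize (filter_and _ _ (filter_and _ _
    (proj1 (is_derive_eps _ _ _) Hg e1 He1) (proj1 (is_derive_eps _ _ _) Hg 1 Rlt_0_1))
    (Hk e2 He2)).
  apply filter_imp; intros t [[H1 H2] H3]; rewrite Hk0.
  set (D := Rabs (t - t0)) in *; assert (HD : 0 <= D) by apply Rabs_pos.
  assert (H4 : Rabs (g t - g t0) <= (Rabs l + 1) * D).
  { replace (g t - g t0) with ((g t - g t0 - l * (t - t0)) + l * (t - t0)) by ring.
    eapply Rle_trans; [apply Rabs_triang|]; rewrite (Rabs_mult l); fold D; lra. }
  replace (k t - 0 - P * l * (t - t0))
    with ((k t - P * (g t - g t0)) + P * (g t - g t0 - l * (t - t0))) by ring.
  eapply Rle_trans; [apply Rabs_triang|]; rewrite (Rabs_mult P).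
  assert (H5 : Rabs P * Rabs (g t - g t0 - l * (t - t0)) <= Rabs P * (e1 * D))
    by (apply Rmult_le_compat_l; assumption).
  assert (H6 : e2 * Rabs (g t - g t0) <= e2 * ((Rabs l + 1) * D))
    by (apply Rmult_le_compat_l; lra).
  assert (H7 : 0 <= e1 * D) by (apply Rmult_le_pos; lra).
  replace (eps * D) with (e2 * (Rabs l + 1) * D + (Rabs P + 1) * e1 * D) by (rewrite E1, E2; field).
  lra.
Qed.

Lemma filterlim_point {T : UniformSpace} (g : T -> point) (t0 : T) (P : point -> Prop) :
  (forall i, continuous (fun t => crd i (g t)) t0) ->
  locally (g t0) P -> locally t0 (fun t => P (g t)).
Proof.
  intros Hg [e He].
  assert (H : forall i, locally t0 (fun t => Rabs (crd i (g t) - crd i (g t0)) < e)).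
  { intros i; exact (proj1 (filterlim_locally _ _) (Hg i) e). }
  generalize (filter_and _ _ (H iu) (filter_and _ _ (H ix) (H iv))).
  apply filter_imp; intros t Ht; apply He, ball_point; intros i; destruct i; apply Ht.
Qed.

Lemma continuous_of_derive (g : R -> R) t0 l : is_derive g t0 l -> continuous g t0.
Proof. intros H; apply (ex_derive_continuous (V := R_NormedModule)); exists l; exact H. Qed.

Lemma is_derive_partial_increment i (U : point -> Prop) f (g : R -> point) t0 (l : ivar -> R) :
  open U -> Cn_on 1 U f -> U (g t0) ->
  (forall j, is_derive (fun t => crd j (g t)) t0 (l j)) ->
  is_derive (fun t => f (g t) - f (set_crd i (g t) (crd i (g t0)))) t0
    (pd i f (g t0) * l i).
Proof.
  intros HU Hf H0 Hg.
  apply (is_derive_along_increment _ (fun t => crd i (g t))); [apply Hg|].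
  intros eps He.
  apply (filterlim_point (T := R_UniformSpace) g t0 (fun q =>
    Rabs (f q - f (set_crd i q (crd i (g t0))) - pd i f (g t0) * (crd i q - crd i (g t0)))
      <= eps * Rabs (crd i q - crd i (g t0)))).
  - intros j; exact (continuous_of_derive _ _ _ (Hg j)).
  - exact (partial_increment i f U (g t0) eps HU Hf H0 He).
Qed.

Definition sum3 (F : ivar -> R) : R := F iu + F ix + F iv.

(** The increment of [f] along [g] telescopes: the coordinates are frozen at their values in [p] one
    after the other, passing through [g1] and [g2], and each difference is a partial increment. *)
Lemma is_derive_curve (U : point -> Prop) f (g : R -> point) t0 (l : ivar -> R) :
  open U -> Cn_on 1 U f -> U (g t0) ->
  (forall j, is_derive (fun t => crd j (g t)) t0 (l j)) ->
  is_derive (fun t => f (g t)) t0 (sum3 (fun i => pd i f (g t0) * l i)).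
Proof.
  intros HU Hf H0 Hg; set (p := g t0).
  set (g1 := fun t => set_crd iu (g t) (crd iu p)).
  set (g2 := fun t => set_crd ix (g1 t) (crd ix p)).
  assert (E1 : g1 t0 = p) by apply set_crd_same.
  assert (E2 : g2 t0 = p) by (unfold g2; rewrite E1; apply set_crd_same).
  assert (D1 := is_derive_partial_increment iu U f g t0 l HU Hf H0 Hg).
  assert (D2 := is_derive_partial_increment ix U f g1 t0
    (fun j => match j with iu => 0 | _ => l j end) HU Hf).
  assert (D3 := is_derive_partial_increment iv U f g2 t0
    (fun j => match j with iv => l j | _ => 0 end) HU Hf).
  rewrite E1 in D2; rewrite E2 in D3; cbv beta iota in D2, D3.
  specialize (D2 H0); specialize (D3 H0).
  (* A frozen coordinate is constant and has velocity 0; the others keep the velocity they have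
     along [g]. *)
  assert (K : forall j c, is_derive (fun _ : R => c) t0 0 /\
     (is_derive (fun t => crd j (g t)) t0 (l j)))
    by (intros j c; split; [apply (is_derive_const (V := R_NormedModule))|apply Hg]).
  specialize (D2 ltac:(intros []; [exact (proj1 (K iu (crd iu p)))|exact (proj2 (K ix 0))|exact (proj2 (K iv 0))])).
  specialize (D3 ltac:(intros []; [exact (proj1 (K iu (crd iu p)))|exact (proj1 (K iu (crd ix p)))|exact (proj2 (K iv 0))])).
  assert (D := is_derive_plus (V := R_NormedModule) _ _ _ _ _
    (is_derive_plus (V := R_NormedModule) _ _ _ _ _
    (is_derive_plus (V := R_NormedModule) _ _ _ _ _ D1 D2) D3)
    (proj1 (K iu (f p)))).
  replace (sum3 _) with (plus (plus (plus (pd iu f p * l iu) (pd ix f p * l ix)) (pd iv f p * l iv)) 0).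
  2: unfold sum3, plus; simpl; unfold p; ring.
  apply (is_derive_ext (V := R_NormedModule)) with (2 := D).
  intros t; unfold plus; simpl.
  change (f (g t) - f (g1 t) + (f (g1 t) - f (g2 t))
    + (f (g2 t) - f (crd iu p, crd ix p, crd iv p)) + f p = f (g t)).
  rewrite crd_eta; ring.
Qed.

(** * Symmetry of mixed partial derivatives *)

Lemma pd_comm (U : point -> Prop) i j f p :
  open U -> Cn_on 2 U f -> U p -> pd i (pd j f) p = pd j (pd i f) p.
Proof.
  intros HU Hf Hp.
  (* Freezing the third coordinate reduces the claim to the two-variable theorem of Schwarz. For
     [i = j] the inner argument [b] is overwritten, which is why the facts about [Q] assume
     [i <> j]. *)
  set (Q := fun a b => set_crd i (set_crd j p b) a).
  assert (HQ : forall P : point -> Prop, locally p P -> i <> j ->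
     locally_2d (fun a b => P (Q a b)) (crd i p) (crd j p)).
  { intros P [e He] Hij; exists e; intros a b Ha Hb; apply He, ball_point.
    assert (He0 := cond_pos e).
    intros k; destruct i, j, k; try congruence; simpl; try assumption;
      rewrite Rminus_eq_0, Rabs_R0; exact He0. }
  destruct Hf as [_ Hf].
  assert (Hcont : forall k l, i <> j ->
    continuity_2d_pt (fun a b => pd k (pd l f) (Q a b)) (crd i p) (crd j p)).
  { intros k l Hij eps.
    apply (HQ (fun q => Rabs (pd k (pd l f) q - pd k (pd l f) (Q (crd i p) (crd j p))) < eps)); [|exact Hij].
    replace (Q (crd i p) (crd j p)) with p
      by (destruct p as [[u x] v], i, j; try congruence; reflexivity).
    assert (Hc : continuous (pd k (pd l f)) p) by exact (proj1 (proj2 (proj2 (proj2 (Hf l)) k)) p Hp).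
    exact (proj1 (filterlim_locally _ _) Hc eps). }
  assert (Hex : locally p (fun q => forall k l, ex_pd k f q /\ ex_pd k (pd l f) q)).
  { generalize (HU p Hp); apply filter_imp; intros q Hq k l.
    exact (conj (proj1 (Hf k) q Hq) (proj1 (proj2 (proj2 (Hf l)) k) q Hq)). }
  assert (HexQ := HQ _ Hex).
  assert (S := Schwarz (fun a b => f (Q a b)) (crd i p) (crd j p)).
  destruct i, j; try reflexivity;
    (apply S;
     [specialize (HexQ ltac:(discriminate)); revert HexQ;
      apply locally_2d_impl, locally_2d_forall; intros a b HexQ
     |match goal with |- continuity_2d_pt _ (crd ?k p) (crd ?l p) =>
        exact (Hcont k l ltac:(discriminate)) end
     |match goal with |- continuity_2d_pt _ (crd ?k p) (crd ?l p) =>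
        exact (Hcont l k ltac:(discriminate)) end]).
  - exact (conj (proj1 (HexQ iu iu)) (conj (proj1 (HexQ ix ix)) (conj (proj2 (HexQ iu ix)) (proj2 (HexQ ix iu))))).
  - exact (conj (proj1 (HexQ iu iu)) (conj (proj1 (HexQ iv iv)) (conj (proj2 (HexQ iu iv)) (proj2 (HexQ iv iu))))).
  - exact (conj (proj1 (HexQ ix ix)) (conj (proj1 (HexQ iu iu)) (conj (proj2 (HexQ ix iu)) (proj2 (HexQ iu ix))))).
  - exact (conj (proj1 (HexQ ix ix)) (conj (proj1 (HexQ iv iv)) (conj (proj2 (HexQ ix iv)) (proj2 (HexQ iv ix))))).
  - exact (conj (proj1 (HexQ iv iv)) (conj (proj1 (HexQ iu iu)) (conj (proj2 (HexQ iv iu)) (proj2 (HexQ iu iv))))).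
  - exact (conj (proj1 (HexQ iv iv)) (conj (proj1 (HexQ ix ix)) (conj (proj2 (HexQ iv ix)) (proj2 (HexQ ix iv))))).
Qed.

Lemma pd_ext_on (U : point -> Prop) i f g p :
  open U -> (forall q, U q -> f q = g q) -> U p -> pd i f p = pd i g p.
Proof. intros HU E Hp; apply pd_ext_loc, (open_locally U); auto. Qed.

Lemma iter_pd_ext_on (U : point -> Prop) i n f g p :
  open U -> (forall q, U q -> f q = g q) -> U p ->
  Nat.iter n (pd i) f p = Nat.iter n (pd i) g p.
Proof.
  intros HU E; revert p; induction n as [|n IH]; intros p Hp; [apply E, Hp|].
  apply (pd_ext_on U); assumption.
Qed.

Lemma smooth_on_iter_pd U i n f : smooth_on U f -> smooth_on U (Nat.iter n (pd i) f).
Proof. intros H; induction n as [|n IH]; [exact H|apply smooth_on_pd, IH]. Qed.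

Lemma smooth_on_pds U m f : smooth_on U f -> smooth_on U (pds m f).
Proof. intros H; repeat apply smooth_on_iter_pd; exact H. Qed.

Lemma pd_iter_pd (U : point -> Prop) i j n f p :
  open U -> smooth_on U f -> U p ->
  pd j (Nat.iter n (pd i) f) p = Nat.iter n (pd i) (pd j f) p.
Proof.
  intros HU Hf; revert p; induction n as [|n IH]; intros p Hp; [reflexivity|].
  simpl; rewrite (pd_comm U); [|exact HU|apply smooth_on_iter_pd, Hf|exact Hp].
  apply (pd_ext_on U); assumption.
Qed.

(** [pds] differentiates in the fixed order v, x, u. A further derivative in u is already outermost;
    one in x or v has to be commuted inwards. *)
Lemma pds_incr (U : point -> Prop) j m f p :
  open U -> smooth_on U f -> U p -> pds (incr j m) f p = pd j (pds m f) p.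
Proof.
  intros HU Hf Hp; unfold pds; destruct j; simpl; [reflexivity|..].
  - rewrite (pd_iter_pd U); [reflexivity|exact HU|repeat apply smooth_on_iter_pd; exact Hf|exact Hp].
  - rewrite (pd_iter_pd U); [|exact HU|repeat apply smooth_on_iter_pd; exact Hf|exact Hp].
    apply (iter_pd_ext_on U); [exact HU| |exact Hp].
    intros q Hq; rewrite (pd_iter_pd U); [reflexivity|exact HU|apply smooth_on_iter_pd; exact Hf|exact Hq].
Qed.

(** * Taylor polynomials *)

Definition everywhere (_ : point) : Prop := True.

Lemma open_everywhere : open everywhere.
Proof. exact open_true. Qed.

Lemma Cn_on_pow n (U : point -> Prop) f k :
  open U -> Cn_on n U f -> Cn_on n U (fun q => f q ^ k).
Proof.
  intros HU Hf; induction k as [|k IH]; [exact (Cn_on_const n U 1)|].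
  apply (Cn_on_mult n U f (fun q => f q ^ k)); assumption.
Qed.

Lemma smooth_on_monomial (U : point -> Prop) p m : open U -> smooth_on U (monomial p m).
Proof.
  intros HU n; unfold monomial.
  assert (H : forall i c k d, Cn_on n U (fun q => (crd i q - c) ^ k / d)).
  { intros i c k d.
    apply (Cn_on_mult n U (fun q => (crd i q - c) ^ k) (fun _ => / d));
      [exact HU| |apply Cn_on_const].
    apply Cn_on_pow; [exact HU|].
    apply (Cn_on_plus n U (crd i) (fun _ => - c));
      [exact HU|apply smooth_on_crd|apply Cn_on_const]. }
  apply (Cn_on_mult n U (fun q => _ * _)); [exact HU| |apply H].
  apply Cn_on_mult; [exact HU|apply H..].
Qed.

Definition list_sum {T} (F : T -> R) (L : list T) : R := fold_right Rplus 0 (map F L).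

Lemma smooth_on_list_sum {T} (U : point -> Prop) (c : T -> R) g (L : list T) :
  open U -> (forall m, smooth_on U (g m)) ->
  smooth_on U (fun q => list_sum (fun m => c m * g m q) L).
Proof.
  intros HU Hg n; unfold list_sum; induction L as [|m L IH]; simpl; [apply Cn_on_const|].
  apply Cn_on_plus; [exact HU| |exact IH].
  apply Cn_on_mult; [exact HU|apply Cn_on_const|apply Hg].
Qed.

Lemma smooth_on_taylor (U : point -> Prop) k th a : open U -> smooth_on U (taylor k th a).
Proof.
  intros HU; apply (smooth_on_list_sum U (fun m => th (fib a m)) (monomial (jpoint th)));
    [exact HU|].
  intros m; apply smooth_on_monomial, HU.
Qed.

Lemma iter_pd_plus i n f g :
  smooth_on everywhere f -> smooth_on everywhere g ->
  Nat.iter n (pd i) (fun q => f q + g q)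
  = fun q => Nat.iter n (pd i) f q + Nat.iter n (pd i) g q.
Proof.
  intros Hf Hg; induction n as [|n IH]; simpl; [reflexivity|]; rewrite IH.
  extensionality q; apply is_pd_unique, is_pd_plus;
    apply (smooth_on_is_pd everywhere); try exact I; apply smooth_on_iter_pd; assumption.
Qed.

Lemma pds_plus m f g :
  smooth_on everywhere f -> smooth_on everywhere g ->
  pds m (fun q => f q + g q) = fun q => pds m f q + pds m g q.
Proof.
  intros Hf Hg; unfold pds; rewrite !iter_pd_plus; auto;
    repeat apply smooth_on_iter_pd; assumption.
Qed.

Lemma iter_pd_scal i n c f :
  Nat.iter n (pd i) (fun q => c * f q) = fun q => c * Nat.iter n (pd i) f q.
Proof.
  induction n as [|n IH]; simpl; [reflexivity|]; rewrite IH.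
  extensionality q; apply Derive_scal.
Qed.

Lemma pds_scal m c f : pds m (fun q => c * f q) = fun q => c * pds m f q.
Proof. unfold pds; rewrite !iter_pd_scal; reflexivity. Qed.

Lemma pds_list_sum {T} m (c : T -> R) g (L : list T) :
  (forall x, smooth_on everywhere (g x)) ->
  pds m (fun q => list_sum (fun x => c x * g x q) L)
  = fun q => list_sum (fun x => c x * pds m (g x) q) L.
Proof.
  intros Hg; unfold list_sum; induction L as [|x L IH]; simpl.
  (* The empty sum is written as [0 * 0] so that homogeneity of [pds] shows its derivatives to
     vanish. *)
  - transitivity (pds m (fun _ => 0 * 0)).
    + f_equal; extensionality q; ring.
    + rewrite (pds_scal m 0 (fun _ => 0)); extensionality q; ring.
  - rewrite pds_plus, pds_scal, IH; [reflexivity| |].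
    + intros n; apply Cn_on_mult; [apply open_everywhere|apply Cn_on_const|apply Hg].
    + apply (smooth_on_list_sum everywhere c g L open_everywhere Hg).
Qed.

(** Taylor monomials have this form, and their partial derivatives reduce to derivatives in one
    variable. *)
Definition separable (A B C : R -> R) : point -> R :=
  fun q => A (crd iu q) * B (crd ix q) * C (crd iv q).

Lemma pds_separable m A B C :
  pds m (separable A B C)
  = separable (Derive_n A (mu m)) (Derive_n B (mx m)) (Derive_n C (mv m)).
Proof.
  assert (Hu : forall n A B C,
    Nat.iter n (pd iu) (separable A B C) = separable (Derive_n A n) B C).
  { intros n A' B' C'; induction n as [|n IH]; simpl; [reflexivity|]; rewrite IH.
    extensionality q; unfold pd, separable; simpl.
    now rewrite !Derive_scal_l. }
  assert (Hx : forall n A B C,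
    Nat.iter n (pd ix) (separable A B C) = separable A (Derive_n B n) C).
  { intros n A' B' C'; induction n as [|n IH]; simpl; [reflexivity|]; rewrite IH.
    extensionality q; unfold pd, separable; simpl.
    now rewrite Derive_scal_l, Derive_scal. }
  assert (Hv : forall n A B C,
    Nat.iter n (pd iv) (separable A B C) = separable A B (Derive_n C n)).
  { intros n A' B' C'; induction n as [|n IH]; simpl; [reflexivity|]; rewrite IH.
    extensionality q; unfold pd, separable; simpl.
    now rewrite Derive_scal. }
  unfold pds; rewrite Hv, Hx, Hu; reflexivity.
Qed.

Lemma Derive_n_monomial c k j :
  Derive_n (fun t => (t - c) ^ k / INR (fact k)) j c = if Nat.eq_dec j k then 1 else 0.
Proof.
  assert (Hf := fun n => INR_fact_neq_0 n).
  transitivity (Derive_n (fun t => / INR (fact k) * (t + - c) ^ k) j c).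
  { apply Derive_n_ext; intros t; unfold Rdiv, Rminus; ring. }
  rewrite Derive_n_scal_l, (Derive_n_comp_trans (fun t => t ^ k)), Derive_n_pow, Rplus_opp_r.
  (* For [j = k] the factorials cancel, for [j < k] a positive power of zero remains, and for
     [j > k] the derivative is zero. *)
  destruct (Nat.eq_dec j k) as [->|Hjk]; destruct (Compare_dec.le_dec _ k); try lia.
  - rewrite Nat.sub_diag; simpl; field; apply Hf.
  - rewrite pow_ne_zero by lia; ring.
  - ring.
Qed.

Lemma pds_monomial p m m' :
  pds m (monomial p m') p
  = (if Nat.eq_dec (mu m) (mu m') then 1 else 0)
    * (if Nat.eq_dec (mx m) (mx m') then 1 else 0)
    * (if Nat.eq_dec (mv m) (mv m') then 1 else 0).
Proof.
  change (monomial p m') with (separable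
    (fun t => (t - crd iu p) ^ mu m' / INR (fact (mu m')))
    (fun t => (t - crd ix p) ^ mx m' / INR (fact (mx m')))
    (fun t => (t - crd iv p) ^ mv m' / INR (fact (mv m')))).
  rewrite pds_separable; unfold separable; now rewrite !Derive_n_monomial.
Qed.

Lemma list_sum_zero {T} (F : T -> R) L : (forall x, F x = 0) -> list_sum F L = 0.
Proof.
  intros H; unfold list_sum; induction L as [|x L IH]; simpl; [reflexivity|].
  rewrite H, IH; ring.
Qed.

Lemma list_sum_seq_single F c s n :
  (s <= c < s + n)%nat -> (forall d, d <> c -> F d = 0) -> list_sum F (seq s n) = F c.
Proof.
  intros Hc HF; unfold list_sum; revert s Hc.
  induction n as [|n IH]; intros s Hc; simpl; [lia|].
  destruct (Nat.eq_dec s c) as [->|Hs].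
  - assert (H : forall s', (c < s')%nat -> fold_right Rplus 0 (map F (seq s' n)) = 0).
    { clear - HF; induction n as [|n IH]; intros s' Hs'; simpl; [reflexivity|].
      rewrite HF, IH by lia; ring. }
    rewrite H by lia; ring.
  - rewrite HF, IH by lia; ring.
Qed.

Lemma list_sum_flat_map {S T} (F : T -> R) (g : S -> list T) L :
  list_sum F (flat_map g L) = list_sum (fun x => list_sum F (g x)) L.
Proof.
  unfold list_sum; induction L as [|x L IH]; simpl; [reflexivity|].
  rewrite map_app, fold_right_app, <- IH; clear IH.
  induction (g x) as [|y M IH]; simpl; [ring|]; rewrite IH; ring.
Qed.

Lemma list_sum_map {S T} (F : T -> R) (g : S -> T) L :
  list_sum F (map g L) = list_sum (fun x => F (g x)) L.
Proof. unfold list_sum; now rewrite map_map. Qed.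

(** At the base point the monomials are dual to the operators [pds], so each of the three nested
    sums over [multis] keeps a single term. *)
Lemma pds_taylor k th a m :
  (msize m <= k)%nat -> pds m (taylor k th a) (jpoint th) = th (fib a m).
Proof.
  intros Hm; unfold taylor.
  change (fun q => fold_right Rplus 0 _)
    with (fun q => list_sum (fun m' => th (fib a m') * monomial (jpoint th) m' q) (multis k)).
  rewrite pds_list_sum by (intros x; apply smooth_on_monomial, open_everywhere).
  unfold multis, msize in *; destruct m as [mu' mx' mv']; simpl in Hm.
  rewrite list_sum_flat_map, (list_sum_seq_single _ mu') by
    first [lia|intros d Hd; rewrite list_sum_flat_map; apply list_sum_zero; intros y;
      rewrite list_sum_map; apply list_sum_zero; intros z;
      rewrite pds_monomial; simpl; destruct (Nat.eq_dec mu' d); [congruence|ring]].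
  rewrite list_sum_flat_map, (list_sum_seq_single _ mx') by
    first [lia|intros d Hd;
      rewrite list_sum_map; apply list_sum_zero; intros z;
      rewrite pds_monomial; simpl; destruct (Nat.eq_dec mx' d); [congruence|ring]].
  rewrite list_sum_map, (list_sum_seq_single _ mv') by
    first [lia|intros d Hd; rewrite pds_monomial; simpl;
      destruct (Nat.eq_dec mv' d); [congruence|ring]].
  rewrite pds_monomial; simpl.
  destruct (Nat.eq_dec mu' mu'), (Nat.eq_dec mx' mx'), (Nat.eq_dec mv' mv');
    congruence || ring.
Qed.

(** On [in_Einf] every coefficient of a monomial of [h] with a positive power of v vanishes. The
    chosen representative thus satisfies h_v = 0 on the whole space and not only at the base
    point. *)
Lemma taylor_h_set_v k th q t :
  in_Einf th -> taylor k th dh (set_crd iv q t) = taylor k th dh q.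
Proof.
  intros HE; unfold taylor; f_equal; apply map_ext; intros [a b [|c]].
  - reflexivity.
  - destruct (HE (msize (Mi a b (S c)))) as [_ H].
    assert (E : th (fib dh (Mi a b (S c))) = 0) by exact (H (Mi a b c) (le_n _)).
    rewrite E; ring.
Qed.

Lemma pd_v_taylor_h k th q : in_Einf th -> pd iv (taylor k th dh) q = 0.
Proof.
  intros HE; apply is_pd_unique; unfold is_pd.
  apply (is_derive_ext (V := R_NormedModule)) with (f := fun _ => taylor k th dh q).
  - intros t; symmetry; apply taylor_h_set_v, HE.
  - apply (is_derive_const (V := R_NormedModule)).
Qed.

(** * Prolongation of a diffeomorphism *)

(** In [E q th] the coefficients depend on the target point [q], while [th] stands for the jet at
    the source point [psi q]. The inductive form lets total derivatives be built term by term. *)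
Inductive affine_form (V : point -> Prop) (k : nat) : (point -> jet -> R) -> Prop :=
  | af_zero : affine_form V k (fun _ _ => 0)
  | af_const f E : smooth_on V f -> affine_form V k E ->
      affine_form V k (fun q th => f q + E q th)
  | af_coord f a m E : smooth_on V f -> (msize m <= k)%nat -> affine_form V k E ->
      affine_form V k (fun q th => f q * th (fib a m) + E q th).

Lemma affine_form_agree V k E q th th' :
  affine_form V k E -> agree k th th' -> E q th = E q th'.
Proof.
  intros HE Ha; induction HE as [|f E Hf _ IH|f a m E Hf Hm _ IH]; [reflexivity|..];
    rewrite IH; [reflexivity|].
  rewrite (Ha (fib a m) Hm); reflexivity.
Qed.

Definition Jac (f : point -> point) (i j : ivar) : point -> R :=
  pd j (fun p => crd i (f p)).

Lemma crd_tangent_map f p X i :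
  crd i (tangent_map f p X) = sum3 (fun j => Jac f i j p * crd j X).
Proof. destruct i; reflexivity. Qed.

(** The nesting to the right and the final [+ 0] follow the constructors of [affine_form]. *)
Lemma push_formula psi s a q :
  let J i j := Jac psi i j q in
  push psi s a q =
  match a with
  | dH => J iu iu * J iv iu + (J iu iu * J iu iu * s dH (psi q)
      + (J iu iu * J ix iu * s dW (psi q) + (J ix iu * J ix iu * s dh (psi q) + 0)))
  | dW => J iu iu * J iv ix + J iu ix * J iv iu
      + ((J iu iu * J iu ix + J iu iu * J iu ix) * s dH (psi q)
      + ((J iu iu * J ix ix + J iu ix * J ix iu) * s dW (psi q)
      + ((J ix iu * J ix ix + J ix iu * J ix ix) * s dh (psi q) + 0)))
  | dh => J iu ix * J iv ix + (J iu ix * J iu ix * s dH (psi q)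
      + (J iu ix * J ix ix * s dW (psi q) + (J ix ix * J ix ix * s dh (psi q) + 0)))
  end.
Proof.
  unfold push, pullback_metric, metric; rewrite !crd_tangent_map.
  destruct a; unfold sum3; cbn [crd fst snd]; ring.
Qed.

Section Prolongation.

Context (U V : point -> Prop) (phi psi : point -> point) (D : diffeo U V phi psi).

Let HU : open U. Proof. apply D. Qed.
Let HV : open V. Proof. apply D. Qed.
Let Hphi p : U p -> V (phi p). Proof. intros Hp; apply D, Hp. Qed.
Let psi_phi p : U p -> psi (phi p) = p. Proof. intros Hp; apply D, Hp. Qed.
Let smooth_phi i : smooth_on U (fun p => crd i (phi p)). Proof. apply D. Qed.
Let smooth_psi i : smooth_on V (fun q => crd i (psi q)). Proof. apply D. Qed.

Lemma smooth_Jac i j : smooth_on V (Jac psi i j).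
Proof. apply smooth_on_pd, smooth_psi. Qed.

Lemma is_pd_comp (W : point -> Prop) f j q :
  open W -> smooth_on W f -> V q -> W (psi q) ->
  is_pd j (fun r => f (psi r)) q (sum3 (fun i => pd i f (psi q) * Jac psi i j q)).
Proof.
  intros HW Hf Hq Hw.
  assert (H := is_derive_curve W f (fun t => psi (set_crd j q t)) (crd j q)
    (fun i => Jac psi i j q) HW (Hf 1%nat)).
  cbv beta in H; rewrite set_crd_same in H; apply (H Hw).
  intros i; exact (smooth_on_is_pd V j _ q (smooth_psi i) Hq).
Qed.

(** Differentiation of [psi (phi p) = p] by the chain rule. *)
Lemma Jac_inverse i j p :
  U p -> sum3 (fun l => Jac psi i l (phi p) * Jac phi l j p) = delta i j.
Proof.
  intros Hp.
  assert (H := is_derive_curve V (fun q => crd i (psi q)) (fun t => phi (set_crd j p t))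
    (crd j p) (fun l => Jac phi l j p) HV (smooth_psi i 1%nat)).
  cbv beta in H; rewrite set_crd_same in H.
  specialize (H (Hphi p Hp) (fun l => smooth_on_is_pd U j _ p (smooth_phi l) Hp)).
  apply is_derive_unique in H; unfold Jac at 1; rewrite <- H.
  apply is_pd_unique with (f := fun r => crd i (psi (phi r))).
  apply (is_pd_ext_loc j (crd i)).
  - apply (open_locally U); auto; intros r Hr; now rewrite psi_phi.
  - replace (delta i j) with (delta j i) by (destruct i, j; reflexivity); apply is_pd_crd.
Qed.

Lemma continuous_comp_psi (f : point -> R) (q : point) : continuous f (psi q) -> V q -> continuous (fun r => f (psi r)) q.
Proof.
  intros Hf Hq; apply (continuous_comp psi f); [|exact Hf].
  intros P; apply (filterlim_point psi q P).
  intros i; apply (Cn_on_continuous 0 V (fun r => crd i (psi r))); [apply smooth_psi|exact Hq].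
Qed.

Definition smooth_section (s : section) : Prop := forall a, smooth_on everywhere (s a).

Lemma is_derive_line a b : is_derive (fun t => a + t * b) 0 b.
Proof. auto_derive; [exact I|ring]. Qed.

(** The curve through [th] that occurs in [invariant_derivation], with velocity the horizontal
    vector of components [b]. *)
Definition jline (th : jet) (b : ivar -> R) (t : R) : jet :=
  fun c => th c + t * sum3 (fun i => b i * total_derivative i th c).

Lemma jpoint_jline_0 th b : jpoint (jline th b 0) = jpoint th.
Proof. unfold jpoint, jline; repeat f_equal; ring. Qed.

Lemma is_derive_jpoint_jline i th b : is_derive (fun t => crd i (jpoint (jline th b t))) 0 (b i).
Proof.
  replace (b i) with (sum3 (fun l => b l * total_derivative l th (base i)))
    by (destruct i; unfold sum3; simpl; ring).
  destruct i; apply is_derive_line.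
Qed.

Lemma is_derive_base_curve f th b :
  smooth_on V f -> U (jpoint th) ->
  is_derive (fun t => f (phi (jpoint (jline th b t)))) 0
    (sum3 (fun j => pd j f (phi (jpoint th))
                    * sum3 (fun i => Jac phi j i (jpoint th) * b i))).
Proof.
  intros Hf Hp.
  assert (Hd : forall j, is_derive (fun t => crd j (phi (jpoint (jline th b t)))) 0
                  (sum3 (fun i => Jac phi j i (jpoint th) * b i))).
  { intros j.
    assert (H := is_derive_curve U (fun p => crd j (phi p)) (fun t => jpoint (jline th b t))
      0 b HU (smooth_phi j 1%nat)).
    cbv beta in H; rewrite jpoint_jline_0 in H.
    apply (H Hp); intros i; apply is_derive_jpoint_jline. }
  assert (H := is_derive_curve V f (fun t => phi (jpoint (jline th b t))) 0
    (fun j => sum3 (fun i => Jac phi j i (jpoint th) * b i)) HV (Hf 1%nat)).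
  cbv beta in H; rewrite jpoint_jline_0 in H.
  exact (H (Hphi _ Hp) Hd).
Qed.

(* [F j] is the total derivative in the direction of the j-th coordinate of V. *)
Lemma affine_form_total_derivative k E :
  affine_form V k E ->
  exists F : ivar -> point -> jet -> R,
    (forall j, affine_form V (S k) (F j)) /\
    (forall s j q, smooth_section s -> V q ->
       is_pd j (fun r => E r (jet_of s (psi r))) q (F j q (jet_of s (psi q)))) /\
    (forall th b, U (jpoint th) ->
       is_derive (fun t => E (phi (jpoint (jline th b t))) (jline th b t)) 0
         (sum3 (fun j => F j (phi (jpoint th)) th
                         * sum3 (fun i => Jac phi j i (jpoint th) * b i)))).
Proof.
  assert (HJ := smooth_Jac).
  induction 1 as [|f E Hf HE [F [HF [HF1 HF2]]]|f a m E Hf Hm HE [F [HF [HF1 HF2]]]].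
  - exists (fun _ _ _ => 0); split; [intros; constructor|split].
    + intros s j q _ _; apply is_pd_const.
    + intros th b _; replace (sum3 _) with 0 by (unfold sum3; ring).
      apply (is_derive_const (V := R_NormedModule)).
  - exists (fun j q th => pd j f q + F j q th); split; [|split].
    + intros j; constructor; [apply smooth_on_pd, Hf|apply HF].
    + intros s j q Hs Hq; apply is_pd_plus; [|exact (HF1 s j q Hs Hq)].
      exact (smooth_on_is_pd V j f q Hf Hq).
    + intros th b Hp.
      assert (H := is_derive_plus (V := R_NormedModule) _ _ _ _ _
        (is_derive_base_curve f th b Hf Hp) (HF2 th b Hp)).
      unfold plus in H; simpl in H.
      match type of H with is_derive _ _ ?d => replace (sum3 _) with d; [exact H|] end.
      unfold sum3; ring.
  (* Product rule: the coefficient is differentiated in the target point, and the fiber coordinate,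
     seen through [psi], contributes the raised coordinates weighted by the Jacobian of [psi]. *)
  - exists (fun j q th => pd j f q * th (fib a m)
      + ((f q * Jac psi iu j q) * th (fib a (incr iu m))
      + ((f q * Jac psi ix j q) * th (fib a (incr ix m))
      + ((f q * Jac psi iv j q) * th (fib a (incr iv m)) + F j q th)))).
    split; [|split].
    + assert (Hm' : forall i, (msize (incr i m) <= S k)%nat)
        by (intros []; unfold msize in *; simpl; lia).
      assert (HfJ : forall i j, smooth_on V (fun q => f q * Jac psi i j q))
        by (intros i j n; apply Cn_on_mult; [exact HV|apply Hf|apply HJ]).
      intros j; repeat (apply (af_coord V (S k) (fun q => _ * _)) || apply af_coord); auto.
      apply smooth_on_pd, Hf.
    + intros s j q Hs Hq.
      assert (H := is_pd_plus _ _ _ _ _ _ (is_pd_mult _ _ _ _ _ _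
        (smooth_on_is_pd V j f q Hf Hq)
        (is_pd_comp everywhere (pds m (s a)) j q open_everywhere
           (smooth_on_pds _ m _ (Hs a)) Hq I)) (HF1 s j q Hs Hq)).
      match type of H with is_pd _ _ _ ?d =>
        match goal with |- is_pd _ _ _ ?d' => replace d' with d; [exact H|] end end.
      unfold sum3, jet_of.
      rewrite !(pds_incr everywhere) by first [apply open_everywhere|apply Hs|exact I].
      ring.
    + intros th b Hp.
      assert (Hy : is_derive (fun t => jline th b t (fib a m)) 0
                 (sum3 (fun i => b i * th (fib a (incr i m)))))
        by (apply is_derive_line).
      assert (H := is_derive_plus (V := R_NormedModule) _ _ _ _ _
        (is_derive_mult _ _ _ _ _ (is_derive_base_curve f th b Hf Hp) Hy Rmult_comm)
        (HF2 th b Hp)).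
      cbv beta in H.
      match type of H with is_derive _ _ ?d => replace (sum3 _) with d; [exact H|] end.
      clear H Hy.
      (* Along the line the fiber coordinate has velocity in terms of [b], whereas the coefficient
         involves [Dphi b]. Writing [b] as [Dpsi (Dphi b)] brings both to the same components. *)
      assert (K : forall i, sum3 (fun j => Jac psi i j (phi (jpoint th))
                 * sum3 (fun l => Jac phi j l (jpoint th) * b l)) = b i).
      { intros i.
        transitivity (sum3 (fun l => sum3 (fun j => Jac psi i j (phi (jpoint th))
                 * Jac phi j l (jpoint th)) * b l)); [unfold sum3; ring|].
        unfold sum3 at 1; rewrite !Jac_inverse by exact Hp.
        destruct i; simpl; ring. }
      rewrite jpoint_jline_0; unfold jline.
      assert (Ku := K iu); assert (Kx := K ix); assert (Kv := K iv); clear K.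
      unfold plus, mult; cbn -[incr]; unfold sum3 in *.
      set (du := Jac phi iu iu _ * _ + _ + _) in *.
      set (dx := Jac phi ix iu _ * _ + _ + _) in *.
      set (dv := Jac phi iv iu _ * _ + _ + _) in *.
      clearbody du dx dv; rewrite <- Ku, <- Kx, <- Kv; ring.
Qed.

Lemma affine_form_continuous k E s (q : point) :
  affine_form V k E -> smooth_section s -> V q ->
  continuous (fun r => E r (jet_of s (psi r))) q.
Proof.
  intros HE Hs Hq; induction HE as [|f E Hf HE IH|f a m E Hf Hm HE IH].
  - apply continuous_const.
  - apply (continuous_plus f (fun r => E r (jet_of s (psi r)))); [|exact IH].
    apply (Cn_on_continuous 0 V); [apply Hf|exact Hq].
  - apply (continuous_plus (fun r => f r * pds m (s a) (psi r))
      (fun r => E r (jet_of s (psi r)))); [|exact IH].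
    apply (continuous_mult f (fun r => pds m (s a) (psi r))).
    + apply (Cn_on_continuous 0 V); [apply Hf|exact Hq].
    + apply continuous_comp_psi; [|exact Hq].
      apply (Cn_on_continuous 0 everywhere); [apply smooth_on_pds, Hs|exact I].
Qed.

(** A partial derivative of an affine form in the jet of [s] is again such a form, of order one
    higher, so the induction on [n] has to let [k] vary. *)
Lemma affine_form_smooth k E s :
  affine_form V k E -> smooth_section s -> smooth_on V (fun r => E r (jet_of s (psi r))).
Proof.
  intros HE Hs n; revert k E HE; induction n as [|n IH]; intros k E HE;
    (split; [intros q Hq; exact (affine_form_continuous k E s q HE Hs Hq)|]); [exact I|].
  destruct (affine_form_total_derivative k E HE) as [F [HF [HF1 _]]].
  intros j; split.
  - intros q Hq; exact (is_pd_ex _ _ _ _ (HF1 s j q Hs Hq)).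
  - apply (Cn_on_ext n V (fun r => F j r (jet_of s (psi r)))); [exact HV| |exact (IH _ _ (HF j))].
    intros q Hq; symmetry; exact (is_pd_unique _ _ _ _ (HF1 s j q Hs Hq)).
Qed.

(** * Jets of the transformed section *)

Lemma push_affine_form a :
  exists E, affine_form V 0 E /\ forall s q, push psi s a q = E q (jet_of s (psi q)).
Proof.
  assert (Hplus : forall f g, smooth_on V f -> smooth_on V g -> smooth_on V (fun q => f q + g q))
    by (intros f g Hf Hg n; apply Cn_on_plus; auto).
  assert (Hmult : forall f g, smooth_on V f -> smooth_on V g -> smooth_on V (fun q => f q * g q))
    by (intros f g Hf Hg n; apply Cn_on_mult; auto).
  assert (HJ := smooth_Jac).
  assert (Hform : forall k cH cW ch,
    smooth_on V k -> smooth_on V cH -> smooth_on V cW -> smooth_on V ch ->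
    affine_form V 0 (fun q th => k q + (cH q * th (fib dH (Mi 0 0 0))
      + (cW q * th (fib dW (Mi 0 0 0)) + (ch q * th (fib dh (Mi 0 0 0)) + 0)))))
    by (intros; repeat constructor; assumption).
  destruct a; refine (ex_intro _ _ (conj (Hform (fun q => _) (fun q => _) (fun q => _)
      (fun q => _) _ _ _ _) (fun s q => push_formula psi s _ q))); auto 10.
Qed.

Lemma smooth_on_push s a : smooth_section s -> smooth_on V (push psi s a).
Proof.
  intros Hs; destruct (push_affine_form a) as [E [HE H]]; intros n.
  apply (Cn_on_ext n V (fun q => E q (jet_of s (psi q)))); [exact HV| |].
  - intros q _; symmetry; apply H.
  - apply (affine_form_smooth 0); assumption.
Qed.

(** Raises one index at a time, so that an induction step is one use of [pds_incr]. *)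
Lemma multi_ind (P : multi -> Prop) :
  P (Mi 0 0 0) -> (forall i m, P m -> P (incr i m)) -> forall m, P m.
Proof.
  intros H0 HS [a b c].
  induction a as [|a IH]; [|exact (HS iu _ IH)].
  induction b as [|b IH]; [|exact (HS ix _ IH)].
  induction c as [|c IH]; [exact H0|exact (HS iv _ IH)].
Qed.

(** The form [E] is chosen before the section: the transformed jet depends on [s] only through its
    jet at the source point. *)
Lemma pds_push_affine_form a m :
  exists E, affine_form V (msize m) E /\
    forall s q, smooth_section s -> V q -> pds m (push psi s a) q = E q (jet_of s (psi q)).
Proof.
  induction m as [|i m [E [HE H]]] using multi_ind.
  - destruct (push_affine_form a) as [E [HE H]]; exists E; split; [exact HE|].
    intros s q _ _; apply H.
  - destruct (affine_form_total_derivative _ E HE) as [F [HF [HF1 _]]].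
    exists (F i); split.
    + replace (msize (incr i m)) with (S (msize m))
        by (destruct i; unfold msize; simpl; lia).
      apply HF.
    + intros s q Hs Hq; rewrite (pds_incr V) by first [exact HV|apply smooth_on_push, Hs|exact Hq].
      rewrite (pd_ext_on V i _ (fun r => E r (jet_of s (psi r)))) by
        first [exact HV|exact Hq|intros r Hr; exact (H s r Hs Hr)].
      exact (is_pd_unique _ _ _ _ (HF1 s i q Hs Hq)).
Qed.

Lemma smooth_section_taylor k th : smooth_section (taylor k th).
Proof. intros a; apply smooth_on_taylor, open_everywhere. Qed.

Lemma agree_jet_of_taylor k th : agree k (jet_of (taylor k th) (jpoint th)) th.
Proof.
  intros [i|a m] Hc; [destruct i; reflexivity|]; apply pds_taylor, Hc.
Qed.

(** [prolong] evaluates this coordinate on the Taylor polynomial of order [msize m], whose jet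
    agrees with [th] to that order. The separate bound [k] allows [S (msize m)] to be used for
    [msize (incr j m)]. *)
Lemma prolong_affine_form a m k E th :
  affine_form V k E -> (k <= msize m)%nat ->
  (forall s q, smooth_section s -> V q -> pds m (push psi s a) q = E q (jet_of s (psi q))) ->
  U (jpoint th) -> prolong phi psi th (fib a m) = E (phi (jpoint th)) th.
Proof.
  intros HE Hk H Hp; unfold prolong, jet_of at 1; simpl corder.
  rewrite H by first [apply smooth_section_taylor|apply Hphi, Hp].
  rewrite psi_phi by exact Hp.
  apply (affine_form_agree V k _ _ _ _ HE).
  intros c Hc; apply agree_jet_of_taylor; lia.
Qed.

Lemma is_derive_prolong th b c :
  U (jpoint th) ->
  is_derive (fun t => prolong phi psi (jline th b t) c) 0
    (sum3 (fun j => sum3 (fun i => Jac phi j i (jpoint th) * b i)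
                    * total_derivative j (prolong phi psi th) c)).
Proof.
  intros Hp.
  (* The affine expression for [prolong] holds over [U] only, so the line must stay above [U] for
     small [t]. *)
  assert (Hloc : locally 0 (fun t => U (jpoint (jline th b t)))).
  { apply (filterlim_point (T := R_UniformSpace) (fun t => jpoint (jline th b t)) 0 U).
    - intros i; exact (continuous_of_derive _ _ _ (is_derive_jpoint_jline i th b)).
    - rewrite jpoint_jline_0; exact (HU _ Hp). }
  destruct c as [i|a m].
  - assert (H := is_derive_curve U (fun p => crd i (phi p)) (fun t => jpoint (jline th b t))
      0 b HU (smooth_phi i 1%nat)).
    cbv beta in H; rewrite jpoint_jline_0 in H.
    specialize (H Hp (fun l => is_derive_jpoint_jline l th b)).
    match type of H with is_derive _ _ ?d => replace (sum3 _) with d; [exact H|] end.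
    unfold Jac, sum3; destruct i; simpl; ring.
  - destruct (pds_push_affine_form a m) as [E [HE H]].
    destruct (affine_form_total_derivative _ E HE) as [F [HF [HF1 HF2]]].
    apply (is_derive_ext_loc (V := R_NormedModule))
      with (f := fun t => E (phi (jpoint (jline th b t))) (jline th b t)).
    { revert Hloc; apply filter_imp; intros t Ht; symmetry.
      exact (prolong_affine_form a m _ E _ HE (le_n _) H Ht). }
    (* The raised coordinate of the transformed jet is the total derivative [F j] of the form that
       computes the coordinate itself. *)
    assert (HFp : forall j, total_derivative j (prolong phi psi th) (fib a m)
                            = F j (phi (jpoint th)) th).
    { intros j; apply (prolong_affine_form a (incr j m) (S (msize m)));
        [apply HF|destruct j; unfold msize; simpl; lia| |exact Hp].
      intros s q Hs Hq.
      rewrite (pds_incr V) by first [exact HV|apply smooth_on_push, Hs|exact Hq].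
      rewrite (pd_ext_on V j _ (fun r => E r (jet_of s (psi r)))) by
        first [exact HV|exact Hq|intros r Hr; exact (H s r Hs Hr)].
      exact (is_pd_unique _ _ _ _ (HF1 s j q Hs Hq)). }
    match goal with |- is_derive _ _ ?d => 
      replace d with (sum3 (fun j => F j (phi (jpoint th)) th
                         * sum3 (fun i => Jac phi j i (jpoint th) * b i))) end.
    + exact (HF2 th b Hp).
    + unfold sum3 at 1 3; rewrite !HFp; ring.
Qed.
End Prolongation.

Lemma diffeo_sym U V phi psi : diffeo U V phi psi -> diffeo V U psi phi.
Proof. intros (HU & HV & H1 & H2 & H3 & H4); exact (conj HV (conj HU (conj H2 (conj H1 (conj H4 H3))))). Qed.

Lemma is_pd_eq i f p l l' : is_pd i f p l -> l = l' -> is_pd i f p l'.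
Proof. intros H <-; exact H. Qed.

(** * The Kundt pseudogroup *)

Section Kundt_transformations.

Context (U V : point -> Prop) (phi psi : point -> point) (G : in_G U V phi psi).

Let D : diffeo U V phi psi. Proof. apply G. Qed.
Let HU : open U. Proof. apply D. Qed.
Let HV : open V. Proof. apply D. Qed.
Notation J := (Jac psi).

Lemma Jac_phi_G p :
  U p ->
  Jac phi iu ix p = 0 /\ Jac phi iu iv p = 0 /\ Jac phi ix iv p = 0 /\
  Jac phi ix ix p <> 0 /\ Jac phi iu iu p <> 0 /\ Jac phi iv iv p = / Jac phi iu iu p.
Proof.
  intros Hp; destruct G as [_ (C & A & B & HG)].
  assert (E : forall i j, Jac phi i j p = pd j (fun q => crd i
    (C (crd iu q), A (crd iu q) (crd ix q),
     crd iv q / Derive C (crd iu q) + B (crd iu q) (crd ix q))) p).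
  { intros i j; apply (pd_ext_on U); [exact HU| |exact Hp].
    intros [[u x] v] Hq; rewrite (proj1 (HG u x v Hq)); reflexivity. }
  destruct p as [[u x] v]; destruct (HG u x v Hp) as (_ & HC & HA).
  assert (Euu : Jac phi iu iu (u, x, v) = Derive C u) by exact (E iu iu).
  rewrite Euu, !E; repeat split; try assumption; unfold pd; simpl.
  1,2,3: apply Derive_const.
  (* At fixed u the last component of [phi] is affine in v with slope [/ Derive C u]. *)
  rewrite (Derive_ext _ (fun t => B u x + / Derive C u * t)) by (intros t; unfold Rdiv; ring).
  apply is_derive_unique; auto_derive; [exact I|ring].
Qed.

(** Solves [Dpsi Dphi = 1] entry by entry: [Dphi] is triangular with nonzero diagonal, and its
    inverse has the same shape. No formula for [psi] in terms of C, A and B is involved. *)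
Lemma Jac_psi_G q :
  V q ->
  J iu ix q = 0 /\ J iu iv q = 0 /\ J ix iv q = 0 /\
  J ix ix q <> 0 /\ J iu iu q <> 0 /\ J iv iv q = / J iu iu q.
Proof.
  intros Hq.
  destruct D as (_ & _ & _ & H2 & _); destruct (H2 q Hq) as [Hp Eq].
  destruct (Jac_phi_G _ Hp) as (Z1 & Z2 & Z3 & N1 & N2 & I1).
  assert (K := fun i j => Jac_inverse U V phi psi D i j (psi q) Hp).
  rewrite Eq in K; set (p := psi q) in *.
  assert (Kuv := K iu iv); assert (Kux := K iu ix); assert (Kxv := K ix iv).
  assert (Kuu := K iu iu); assert (Kvv := K iv iv); assert (Kxx := K ix ix); clear K.
  unfold sum3 in *; simpl in *.
  rewrite Z1, Z2, Z3, ?I1 in *.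
  assert (E1 : J iu iv q = 0).
  { apply (Rmult_eq_reg_r (/ Jac phi iu iu p)); [lra|now apply Rinv_neq_0_compat]. }
  assert (E2 : J iu ix q = 0).
  { rewrite E1 in Kux; apply (Rmult_eq_reg_r (Jac phi ix ix p)); [lra|exact N1]. }
  assert (E3 : J ix iv q = 0).
  { apply (Rmult_eq_reg_r (/ Jac phi iu iu p)); [lra|now apply Rinv_neq_0_compat]. }
  rewrite E1, E2, E3 in *.
  assert (E4 : J iu iu q * Jac phi iu iu p = 1) by lra.
  assert (E5 : J ix ix q * Jac phi ix ix p = 1) by lra.
  assert (E6 : J iv iv q * / Jac phi iu iu p = 1) by lra.
  assert (E7 : J iu iu q <> 0) by (intros E; rewrite E in E4; lra).
  repeat split; try assumption.
  - intros E; rewrite E in E5; lra.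
  - assert (E8 : Jac phi iu iu p = / J iu iu q).
    { apply (Rmult_eq_reg_l (J iu iu q)); [|exact E7]; rewrite E4; field; exact E7. }
    rewrite <- E8.
    apply (Rmult_eq_reg_r (/ Jac phi iu iu p)); [|now apply Rinv_neq_0_compat].
    rewrite E6; field; exact N2.
Qed.

Let smooth_J i j : smooth_on V (J i j).
Proof. exact (smooth_Jac U V phi psi D i j). Qed.

Lemma is_pd_Jac k i j q : V q -> is_pd k (J i j) q (pd k (J i j) q).
Proof. apply smooth_on_is_pd, smooth_J. Qed.

Lemma pd_zero_on f k q : (forall r, V r -> f r = 0) -> V q -> pd k f q = 0.
Proof.
  intros H Hq; rewrite (pd_ext_on V k f (fun _ => 0)) by (try exact HV; assumption).
  apply is_pd_unique, is_pd_const.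
Qed.

Lemma pd_Jac_comm i j k q : V q -> pd k (J i j) q = pd j (J i k) q.
Proof.
  intros Hq; apply (pd_comm V); [exact HV| |exact Hq].
  destruct D as (_ & _ & _ & _ & _ & H); exact (H i 2%nat).
Qed.

(** Exchanging the order of differentiation turns most of these into derivatives of entries that
    vanish on [V]. *)
Lemma pd_Jac_psi_G q :
  V q ->
  pd iv (J iu iu) q = 0 /\ pd ix (J iu iu) q = 0 /\ pd iv (J ix iu) q = 0 /\
  pd iv (J ix ix) q = 0 /\ pd ix (J iv iv) q = 0 /\ pd iv (J iv iv) q = 0.
Proof.
  assert (H := Jac_psi_G).
  assert (Zv : forall r, V r -> pd iv (J iu iu) r = 0).
  { intros r Hr; rewrite pd_Jac_comm by exact Hr; apply pd_zero_on; [apply H|exact Hr]. }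
  assert (Zx : forall r, V r -> pd ix (J iu iu) r = 0).
  { intros r Hr; rewrite pd_Jac_comm by exact Hr; apply pd_zero_on; [apply H|exact Hr]. }
  (* For [J iv iv] the identity [J iv iv * J iu iu = 1] is differentiated. *)
  assert (Hvv : forall k r, V r -> pd k (J iu iu) r = 0 -> pd k (J iv iv) r = 0).
  { intros k r Hr E.
    assert (E1 := is_pd_mult _ _ _ _ _ _ (is_pd_Jac k iv iv r Hr) (is_pd_Jac k iu iu r Hr)).
    apply is_pd_unique in E1.
    rewrite (pd_ext_on V k _ (fun _ => 1)) in E1 by first [exact HV|exact Hr|
      intros t Ht; destruct (H t Ht) as (_ & _ & _ & _ & N & ->); field; exact N].
    rewrite (is_pd_unique _ _ _ _ (is_pd_const k 1 r)), E in E1.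
    apply (Rmult_eq_reg_r (J iu iu r)); [lra|apply H, Hr]. }
  intros Hq; repeat split.
  - apply Zv, Hq.
  - apply Zx, Hq.
  - rewrite pd_Jac_comm by exact Hq; apply pd_zero_on; [apply H|exact Hq].
  - rewrite pd_Jac_comm by exact Hq; apply pd_zero_on; [apply H|exact Hq].
  - apply Hvv, Zx; exact Hq.
  - apply Hvv, Zv; exact Hq.
Qed.

Lemma pd_v_Jac_vx q : V q -> pd iv (J iv ix) q = 0.
Proof. intros Hq; rewrite pd_Jac_comm by exact Hq; exact (proj1 (proj2 (proj2 (proj2 (proj2 (pd_Jac_psi_G q Hq)))))). Qed.

(* [J iv iv] depends on u only, and d_v [J iv iu] = d_u [J iv iv]. *)
Lemma pd_pd_v_Jac_vu k q : V q -> k <> iu -> pd k (pd iv (J iv iu)) q = 0.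
Proof.
  intros Hq Hk.
  rewrite (pd_ext_on V k _ (pd iu (J iv iv))) by
    first [exact HV|exact Hq|intros r Hr; apply pd_Jac_comm, Hr].
  rewrite (pd_comm V) by first [exact HV|exact Hq|apply smooth_J].
  apply pd_zero_on; [|exact Hq].
  intros r Hr; destruct (pd_Jac_psi_G r Hr) as (_ & _ & _ & _ & Ex & Ev).
  destruct k; [congruence|exact Ex|exact Ev].
Qed.

(** * Transformation of the derivatives of a Kundt metric *)

Section Transformed_jets.

Context (s : section) (Hs : smooth_section s) (Hv : forall q, pd iv (s dh) q = 0).

Lemma is_pd_pull f k q :
  smooth_on everywhere f -> V q ->
  is_pd k (fun r => f (psi r)) q (sum3 (fun i => pd i f (psi q) * J i k q)).
Proof.
  intros Hf Hq; exact (is_pd_comp U V phi psi D everywhere f k q open_everywhere Hf Hq I).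
Qed.

(** Differentiates by the shape of the function; the resulting value is compared with the desired
    one afterwards through [is_pd_eq]. *)
Ltac is_pd_step Hq :=
  lazymatch goal with
  | |- is_pd ?k (fun r => @?f r + @?g r) ?q _ => refine (is_pd_plus k f g q _ _ _ _)
  | |- is_pd ?k (fun r => @?f r * @?g r) ?q _ => refine (is_pd_mult k f g q _ _ _ _)
  | |- is_pd ?k (fun r => s ?a (psi r)) ?q _ =>
      exact (is_pd_pull (s a) k q (Hs a) Hq)
  | |- is_pd ?k (fun r => pd iv (s ?a) (psi r)) ?q _ =>
      exact (is_pd_pull (pd iv (s a)) k q (smooth_on_pd _ iv _ (Hs a)) Hq)
  | |- is_pd ?k (fun r => Jac _ ?i ?j r) ?q _ => exact (is_pd_Jac k i j q Hq)
  | |- is_pd ?k (fun r => pd iv (Jac _ ?i ?j) r) ?q _ =>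
      exact (smooth_on_is_pd V k _ q (smooth_on_pd _ iv _ (smooth_J i j)) Hq)
  | |- is_pd ?k (fun _ => ?c) ?q _ => exact (is_pd_const k c q)
  end.

Lemma push_h q : V q -> push psi s dh q = J ix ix q * J ix ix q * s dh (psi q).
Proof.
  intros Hq; rewrite push_formula; destruct (Jac_psi_G q Hq) as (-> & _); ring.
Qed.

Lemma push_h_x q :
  V q ->
  pd ix (push psi s dh) q
  = J ix ix q * J ix ix q * J ix ix q * pd ix (s dh) (psi q)
    + 2 * J ix ix q * pd ix (J ix ix) q * s dh (psi q).
Proof.
  intros Hq; rewrite (pd_ext_on V ix _ _ q HV push_h Hq).
  apply is_pd_unique; eapply is_pd_eq.
  - apply (is_pd_mult ix (fun r => J ix ix r * J ix ix r) (fun r => s dh (psi r)));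
      [apply is_pd_mult; apply is_pd_Jac, Hq|exact (is_pd_pull _ ix q (Hs dh) Hq)].
  - destruct (Jac_psi_G q Hq) as (Z1 & Z2 & _); unfold sum3; rewrite Z1, Hv; ring.
Qed.

(** All terms with second derivatives of [psi] vanish, as does h_v, and the factor [J iu iu] cancels
    against [J iv iv]. *)
Lemma push_W_v q : V q -> pd iv (push psi s dW) q = J ix ix q * pd iv (s dW) (psi q).
Proof.
  intros Hq.
  rewrite (pd_ext_on V iv _ (fun r => J iu iu r * J iv ix r
      + J iu iu r * J ix ix r * s dW (psi r)
      + (J ix iu r * J ix ix r) * (2 * s dh (psi r))) q HV) by
    first [exact Hq|intros r Hr; rewrite push_formula;
      destruct (Jac_psi_G r Hr) as (-> & _); ring].
  apply is_pd_unique; eapply is_pd_eq.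
  - repeat is_pd_step Hq.
  - destruct (Jac_psi_G q Hq) as (Z1 & Z2 & Z3 & N1 & N2 & I1).
    destruct (pd_Jac_psi_G q Hq) as (D1 & D2 & D3 & D4 & _).
    unfold sum3; rewrite pd_v_Jac_vx, Z2, Z3, I1, D1, D3, D4, Hv by exact Hq.
    field; exact N2.
Qed.

(** The inhomogeneous first term is a function of u alone, so it disappears after one more
    derivative in x or v. *)
Lemma push_H_v q :
  V q ->
  pd iv (push psi s dH) q
  = J iu iu q * pd iv (J iv iu) q + J iu iu q * pd iv (s dH) (psi q)
    + J ix iu q * pd iv (s dW) (psi q).
Proof.
  intros Hq.
  rewrite (pd_ext_on V iv _ (fun r => J iu iu r * J iv iu r
      + J iu iu r * J iu iu r * s dH (psi r) + J iu iu r * J ix iu r * s dW (psi r)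
      + J ix iu r * J ix iu r * s dh (psi r)) q HV) by
    first [exact Hq|intros r Hr; rewrite push_formula; ring].
  apply is_pd_unique; eapply is_pd_eq.
  - repeat is_pd_step Hq.
  - destruct (Jac_psi_G q Hq) as (Z1 & Z2 & Z3 & N1 & N2 & I1).
    destruct (pd_Jac_psi_G q Hq) as (D1 & D2 & D3 & D4 & _).
    unfold sum3; rewrite Z2, Z3, I1, D1, D3, Hv by exact Hq.
    field; exact N2.
Qed.

Lemma pd_push_W_v k q :
  V q ->
  pd k (pd iv (push psi s dW)) q
  = pd k (J ix ix) q * pd iv (s dW) (psi q)
    + J ix ix q * sum3 (fun i => pd i (pd iv (s dW)) (psi q) * J i k q).
Proof.
  intros Hq; rewrite (pd_ext_on V k _ _ q HV push_W_v Hq).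
  exact (is_pd_unique _ _ _ _
    (is_pd_mult k (J ix ix) (fun r => pd iv (s dW) (psi r)) q _ _ (is_pd_Jac k ix ix q Hq)
      (is_pd_pull _ k q (smooth_on_pd _ iv _ (Hs dW)) Hq))).
Qed.

Lemma push_W_vv q :
  V q -> pd iv (pd iv (push psi s dW)) q = J ix ix q / J iu iu q * pd iv (pd iv (s dW)) (psi q).
Proof.
  intros Hq; rewrite pd_push_W_v by exact Hq.
  destruct (Jac_psi_G q Hq) as (Z1 & Z2 & Z3 & N1 & N2 & I1).
  destruct (pd_Jac_psi_G q Hq) as (_ & _ & _ & D4 & _).
  unfold sum3; rewrite Z2, Z3, I1, D4; field; exact N2.
Qed.

Lemma push_W_xv q :
  V q ->
  pd ix (pd iv (push psi s dW)) q
  = pd ix (J ix ix) q * pd iv (s dW) (psi q)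
    + J ix ix q * (pd ix (pd iv (s dW)) (psi q) * J ix ix q
                   + pd iv (pd iv (s dW)) (psi q) * J iv ix q).
Proof.
  intros Hq; rewrite pd_push_W_v by exact Hq.
  destruct (Jac_psi_G q Hq) as (Z1 & _); unfold sum3; rewrite Z1; ring.
Qed.

Lemma pd_push_H_v k q :
  V q -> k <> iu ->
  pd k (pd iv (push psi s dH)) q
  = J iu iu q * sum3 (fun i => pd i (pd iv (s dH)) (psi q) * J i k q)
    + pd k (J ix iu) q * pd iv (s dW) (psi q)
    + J ix iu q * sum3 (fun i => pd i (pd iv (s dW)) (psi q) * J i k q).
Proof.
  intros Hq Hk; rewrite (pd_ext_on V k _ _ q HV push_H_v Hq).
  apply is_pd_unique; eapply is_pd_eq.
  - repeat is_pd_step Hq.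
  - rewrite pd_pd_v_Jac_vu by assumption.
    assert (E : pd k (J iu iu) q = 0)
      by (destruct (pd_Jac_psi_G q Hq) as (Ev & Ex & _);
          destruct k; [congruence|exact Ex|exact Ev]).
    rewrite E; ring.
Qed.

Lemma push_H_vv q :
  V q ->
  pd iv (pd iv (push psi s dH)) q
  = pd iv (pd iv (s dH)) (psi q) + J ix iu q / J iu iu q * pd iv (pd iv (s dW)) (psi q).
Proof.
  intros Hq; rewrite pd_push_H_v by (discriminate || exact Hq).
  destruct (Jac_psi_G q Hq) as (Z1 & Z2 & Z3 & N1 & N2 & I1).
  destruct (pd_Jac_psi_G q Hq) as (_ & _ & D3 & _).
  unfold sum3; rewrite Z2, Z3, I1, D3; field; exact N2.
Qed.

Lemma push_H_xv q :
  V q ->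
  pd ix (pd iv (push psi s dH)) q
  = J iu iu q * (pd ix (pd iv (s dH)) (psi q) * J ix ix q
                 + pd iv (pd iv (s dH)) (psi q) * J iv ix q)
    + pd iu (J ix ix) q * pd iv (s dW) (psi q)
    + J ix iu q * (pd ix (pd iv (s dW)) (psi q) * J ix ix q
                   + pd iv (pd iv (s dW)) (psi q) * J iv ix q).
Proof.
  intros Hq; rewrite pd_push_H_v by (discriminate || exact Hq).
  (* In this form the second derivative of [psi] is the one that occurs in the transformed W_uv, so
     it cancels in W_uv - H_xv. *)
  rewrite (pd_Jac_comm ix iu ix q Hq).
  destruct (Jac_psi_G q Hq) as (Z1 & _); unfold sum3; rewrite Z1; ring.
Qed.

End Transformed_jets.
End Kundt_transformations.

(** * A criterion for invariance in terms of the Jacobian of the inverse *)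

Lemma invariant_derivation_intro N r :
  on_jets_of_order r N ->
  (forall U V phi psi, in_G U V phi psi ->
   forall th, in_Einf th -> U (jpoint th) -> hdom N th ->
     hdom N (prolong phi psi th) /\
     forall i, sum3 (fun j => Jac psi i j (phi (jpoint th))
                              * hcoef N j (prolong phi psi th)) = hcoef N i th) ->
  invariant_derivation N.
Proof.
  intros Hr H; split; [exists r; exact Hr|].
  intros U V phi psi G th HE Hp Hd.
  destruct (H U V phi psi G th HE Hp Hd) as [H1 H2]; split; [exact H1|]; intros c.
  assert (D := proj1 G).
  assert (HD := is_derive_prolong U V phi psi D th (fun i => hcoef N i th) c Hp).
  assert (E : forall j, sum3 (fun i => Jac phi j i (jpoint th) * hcoef N i th)
                        = hcoef N j (prolong phi psi th)).
  { intros j.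
    destruct D as (_ & _ & D1 & _); destruct (D1 _ Hp) as [Hq Eq].
    (* With the roles of [phi] and [psi] exchanged, [Dphi] inverts [Dpsi]; applied to the assumed
       identity it yields [Dphi N = N']. *)
    assert (K := fun j l => Jac_inverse V U psi phi (diffeo_sym _ _ _ _ (proj1 G)) j l _ Hq).
    rewrite Eq in K.
    transitivity (sum3 (fun l => sum3 (fun i => Jac phi j i (jpoint th)
       * Jac psi i l (phi (jpoint th))) * hcoef N l (prolong phi psi th))).
    - unfold sum3 at 1; rewrite <- !H2; unfold sum3; ring.
    - unfold sum3 at 1; rewrite !K; destruct j; simpl; ring. }
  assert (EN : hvect N (prolong phi psi th) c
    = sum3 (fun j => sum3 (fun i => Jac phi j i (jpoint th) * hcoef N i th)
                     * total_derivative j (prolong phi psi th) c))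
    by (unfold sum3 at 1; rewrite !E; reflexivity).
  rewrite EN; exact HD.
Qed.

(** * Transformed jet coordinates of order at most two *)

Section Prolonged_jets.

Context (U V : point -> Prop) (phi psi : point -> point) (G : in_G U V phi psi).
Context (th : jet) (HE : in_Einf th) (Hp : U (jpoint th)).

Notation J i j := (Jac psi i j (phi (jpoint th))).
Notation dJ k i j := (pd k (Jac psi i j) (phi (jpoint th))).
Notation th' := (prolong phi psi th).

Let Hq : V (phi (jpoint th)).
Proof. apply G, Hp. Qed.

(** The formulas for [push] evaluate the section at [psi (phi (jpoint th))], which is the base point
    of its Taylor polynomial. *)
Let E k a m : (msize m <= k)%nat -> pds m (taylor k th a) (psi (phi (jpoint th))) = th (fib a m).
Proof.
  intros Hm; destruct G as [(_ & _ & H & _) _]; rewrite (proj2 (H _ Hp)).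
  apply pds_taylor, Hm.
Qed.

Let Hs k := smooth_section_taylor k th.
Let Hv k q := pd_v_taylor_h k th q HE.

Lemma prolong_h : h_ th' = J ix ix * J ix ix * h_ th.
Proof.
  transitivity (J ix ix * J ix ix * taylor 0 th dh (psi (phi (jpoint th)))).
  - exact (push_h U V phi psi G (taylor 0 th) _ Hq).
  - f_equal; exact (E 0 dh (Mi 0 0 0) (le_n _)).
Qed.

Lemma prolong_h_x :
  h_x th' = J ix ix * J ix ix * J ix ix * h_x th + 2 * J ix ix * dJ ix ix ix * h_ th.
Proof.
  etransitivity; [exact (push_h_x U V phi psi G (taylor 1 th) (Hs 1) (Hv 1) _ Hq)|].
  f_equal; f_equal; [exact (E 1 dh (Mi 0 1 0) (le_n _))|exact (E 1 dh (Mi 0 0 0) (le_S _ _ (le_n _)))].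
Qed.

Lemma prolong_W_v : W_v th' = J ix ix * W_v th.
Proof.
  etransitivity; [exact (push_W_v U V phi psi G (taylor 1 th) (Hs 1) (Hv 1) _ Hq)|].
  f_equal; exact (E 1 dW (Mi 0 0 1) (le_n _)).
Qed.

(** Second-order coordinates are computed by [prolong] on the Taylor polynomial of order 2, which
    must reproduce the first-order W_v as well. *)
Let Wv2 : pd iv (taylor 2 th dW) (psi (phi (jpoint th))) = W_v th.
Proof. exact (E 2 dW (Mi 0 0 1) (le_S _ _ (le_n _))). Qed.
Let Wvv2 : pd iv (pd iv (taylor 2 th dW)) (psi (phi (jpoint th))) = W_vv th.
Proof. exact (E 2 dW (Mi 0 0 2) (le_n _)). Qed.
Let Wxv2 : pd ix (pd iv (taylor 2 th dW)) (psi (phi (jpoint th))) = W_xv th.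
Proof. exact (E 2 dW (Mi 0 1 1) (le_n _)). Qed.
Let Wuv2 : pd iu (pd iv (taylor 2 th dW)) (psi (phi (jpoint th))) = W_uv th.
Proof. exact (E 2 dW (Mi 1 0 1) (le_n _)). Qed.
Let Hvv2 : pd iv (pd iv (taylor 2 th dH)) (psi (phi (jpoint th))) = H_vv th.
Proof. exact (E 2 dH (Mi 0 0 2) (le_n _)). Qed.
Let Hxv2 : pd ix (pd iv (taylor 2 th dH)) (psi (phi (jpoint th))) = H_xv th.
Proof. exact (E 2 dH (Mi 0 1 1) (le_n _)). Qed.

Lemma prolong_W_vv : W_vv th' = J ix ix / J iu iu * W_vv th.
Proof.
  etransitivity; [exact (push_W_vv U V phi psi G (taylor 2 th) (Hs 2) (Hv 2) _ Hq)|].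
  now rewrite Wvv2.
Qed.

Lemma prolong_W_xv :
  W_xv th' = dJ ix ix ix * W_v th + J ix ix * (W_xv th * J ix ix + W_vv th * J iv ix).
Proof.
  etransitivity; [exact (push_W_xv U V phi psi G (taylor 2 th) (Hs 2) (Hv 2) _ Hq)|].
  now rewrite Wv2, Wvv2, Wxv2.
Qed.

Lemma prolong_W_uv :
  W_uv th' = dJ iu ix ix * W_v th
    + J ix ix * (W_uv th * J iu iu + W_xv th * J ix iu + W_vv th * J iv iu).
Proof.
  etransitivity; [exact (pd_push_W_v U V phi psi G (taylor 2 th) (Hs 2) (Hv 2) iu _ Hq)|].
  unfold sum3; now rewrite Wv2, Wvv2, Wxv2, Wuv2.
Qed.

Lemma prolong_H_vv : H_vv th' = H_vv th + J ix iu / J iu iu * W_vv th.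
Proof.
  etransitivity; [exact (push_H_vv U V phi psi G (taylor 2 th) (Hs 2) (Hv 2) _ Hq)|].
  now rewrite Wvv2, Hvv2.
Qed.

Lemma prolong_H_xv :
  H_xv th' = J iu iu * (H_xv th * J ix ix + H_vv th * J iv ix) + dJ iu ix ix * W_v th
    + J ix iu * (W_xv th * J ix ix + W_vv th * J iv ix).
Proof.
  etransitivity; [exact (push_H_xv U V phi psi G (taylor 2 th) (Hs 2) (Hv 2) _ Hq)|].
  now rewrite Wv2, Wvv2, Wxv2, Hvv2, Hxv2.
Qed.

(** Together with the next lemma this makes the domains of the three fields invariant. *)
Lemma W_v_prolong_neq_0 : W_v th <> 0 -> W_v th' <> 0.
Proof.
  intros H; rewrite prolong_W_v; apply Rmult_integral_contrapositive_currified; [|exact H].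
  apply (Jac_psi_G U V phi psi G _ Hq).
Qed.

Lemma W_vv_prolong_neq_0 : W_vv th <> 0 -> W_vv th' <> 0.
Proof.
  intros H; rewrite prolong_W_vv.
  destruct (Jac_psi_G U V phi psi G _ Hq) as (_ & _ & _ & N1 & N2 & _).
  repeat apply Rmult_integral_contrapositive_currified; auto using Rinv_neq_0_compat.
Qed.

End Prolonged_jets.

(** * Invariance of the three derivations *)

Lemma agree_fib k th th' a m : agree k th th' -> (msize m <= k)%nat -> th (fib a m) = th' (fib a m).
Proof. intros H Hm; exact (H (fib a m) Hm). Qed.

Ltac agree2 H :=
  intros th th' H;
  unfold nabla1, nabla2, nabla3, hdom, hcoef, h_, h_x, W_v, W_vv, W_xv, W_uv, H_vv, H_xv;
  split; [|intros i];
  rewrite ?(agree_fib 2 th th' dW _ H), ?(agree_fib 2 th th' dH _ H),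
    ?(agree_fib 2 th th' dh _ H) by (unfold msize; simpl; lia);
  reflexivity.

Lemma nabla1_order_2 : on_jets_of_order 2 nabla1.
Proof. agree2 H. Qed.
Lemma nabla2_order_2 : on_jets_of_order 2 nabla2.
Proof. agree2 H. Qed.
Lemma nabla3_order_2 : on_jets_of_order 2 nabla3.
Proof. agree2 H. Qed.

(** The quotient W_v / W_vv is multiplied by [J iu iu], which [J iv iv] undoes. *)
Lemma nabla1_invariant : invariant_derivation nabla1.
Proof.
  apply (invariant_derivation_intro _ 2 nabla1_order_2).
  intros U V phi psi G th HE Hp Hd; simpl in Hd.
  split; [exact (W_vv_prolong_neq_0 U V phi psi G th HE Hp Hd)|].
  assert (Hq : V (phi (jpoint th))) by apply G, Hp.
  destruct (Jac_psi_G U V phi psi G _ Hq) as (Z1 & Z2 & Z3 & N1 & N2 & I1).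
  intros i; unfold sum3; simpl.
  rewrite (prolong_W_v U V phi psi G th HE Hp), (prolong_W_vv U V phi psi G th HE Hp).
  destruct i; rewrite ?Z2, ?Z3, ?I1; field; auto.
Qed.

(** In h_x W_v - 2 h W_xv the terms with [pd ix (J ix ix)] cancel. What remains, a multiple of
    [J iv ix], compensates the contribution of the x-component to the v-component. *)
Lemma nabla2_invariant : invariant_derivation nabla2.
Proof.
  apply (invariant_derivation_intro _ 2 nabla2_order_2).
  intros U V phi psi G th HE Hp Hd; simpl in Hd; destruct Hd as [Hd1 Hd2].
  split; [split; [exact (W_v_prolong_neq_0 U V phi psi G th HE Hp Hd1)
                 |exact (W_vv_prolong_neq_0 U V phi psi G th HE Hp Hd2)]|].
  assert (Hq : V (phi (jpoint th))) by apply G, Hp.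
  assert (Hh : h_ th <> 0) by (apply Rgt_not_eq, (HE 0%nat)).
  destruct (Jac_psi_G U V phi psi G _ Hq) as (Z1 & Z2 & Z3 & N1 & N2 & I1).
  intros i; unfold sum3; simpl.
  rewrite (prolong_W_v U V phi psi G th HE Hp), (prolong_W_vv U V phi psi G th HE Hp),
    (prolong_W_xv U V phi psi G th HE Hp), (prolong_h U V phi psi G th Hp),
    (prolong_h_x U V phi psi G th HE Hp).
  destruct i; rewrite ?Z1, ?Z2, ?Z3, ?I1; field; auto.
Qed.

(** The shift of H_vv by a multiple of W_vv compensates the u-component through [J ix iu]. In W_uv -
    H_xv the terms with [pd iu (J ix ix)] and W_xv cancel, and the rest balances [J iv iu] and
    [J iv ix]. *)
Lemma nabla3_invariant : invariant_derivation nabla3.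
Proof.
  apply (invariant_derivation_intro _ 2 nabla3_order_2).
  intros U V phi psi G th HE Hp Hd; simpl in Hd.
  split; [exact (W_v_prolong_neq_0 U V phi psi G th HE Hp Hd)|].
  assert (Hq : V (phi (jpoint th))) by apply G, Hp.
  destruct (Jac_psi_G U V phi psi G _ Hq) as (Z1 & Z2 & Z3 & N1 & N2 & I1).
  intros i; unfold sum3; simpl.
  rewrite (prolong_W_v U V phi psi G th HE Hp), (prolong_W_vv U V phi psi G th HE Hp),
    (prolong_W_uv U V phi psi G th HE Hp), (prolong_H_vv U V phi psi G th HE Hp),
    (prolong_H_xv U V phi psi G th HE Hp).
  destruct i; rewrite ?Z1, ?Z2, ?Z3, ?I1; field; auto.
Qed.

(** * Independence *)

Definition regular_jets (th : jet) : Prop := in_E 2 th /\ W_v th * W_vv th <> 0.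

Lemma zariski_open_regular_jets : zariski_open 2 regular_jets.
Proof.
  split; [intros th H; apply H|]; intros th0 Hh; split.
  (* The witness changes [th0] only in positive order: W_v and W_vv become 1 and all v-derivatives
     of h become 0. *)
  - exists (fun c => match c with
      | fib dW (Mi 0 0 1) | fib dW (Mi 0 0 2) => 1
      | fib dh (Mi _ _ (S _)) => 0
      | _ => th0 c
      end).
    split; [|split; [split; [exact Hh|intros [a b c] _; reflexivity]|]].
    + intros [i|[| |] [[|a] [|b] [|c]]]; intros Hc; simpl in Hc; unfold msize in Hc; simpl in Hc;
        reflexivity || lia.
    + unfold W_v, W_vv; intros H; lra.
  (* A single polynomial, W_v W_vv, cuts out the complement in every fiber. *)
  - exists (fun P => P = fun th => W_v th * W_vv th); split.
    + intros P ->; apply fp_mul; apply fp_coord; unfold msize; simpl; lia.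
    + intros th _; split.
      * intros [H1 H2]; split; [exact H1|]; eexists; split; [reflexivity|exact H2].
      * intros [H1 [P [-> H2]]]; split; assumption.
Qed.

Lemma nabla_independent th :
  W_v th <> 0 -> W_vv th <> 0 -> independent_at nabla1 nabla2 nabla3 th.
Proof.
  intros H1 H2 l1 l2 l3 H.
  (* The base coordinates already suffice, since there the total derivatives are the unit vectors.
     The u-equation involves only [l3], then the x-equation only [l2], then the v-equation only
     [l1]. *)
  assert (Hu := H (base iu)); assert (Hx := H (base ix)); assert (Hv := H (base iv)); clear H.
  unfold hvect in *; simpl in *.
  assert (E3 : l3 = 0).
  { apply (Rmult_eq_reg_r (1 / W_v th * - W_vv th)); [lra|].
    apply Rmult_integral_contrapositive_currified; [|lra].
    apply Rmult_integral_contrapositive_currified; [lra|now apply Rinv_neq_0_compat]. }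
  subst l3.
  assert (E2 : l2 = 0).
  { apply (Rmult_eq_reg_r (2 / W_v th)); [lra|].
    apply Rmult_integral_contrapositive_currified; [lra|now apply Rinv_neq_0_compat]. }
  subst l2; repeat split.
  apply (Rmult_eq_reg_r (W_v th / W_vv th)); [lra|].
  apply Rmult_integral_contrapositive_currified; [lra|now apply Rinv_neq_0_compat].
Qed.

Theorem proposition10 :
  invariant_derivation nabla1 /\
  invariant_derivation nabla2 /\
  invariant_derivation nabla3 /\
  exists Om : jet -> Prop,
    zariski_open 2 Om /\
    forall th, Om th ->
      hdom nabla1 th /\ hdom nabla2 th /\ hdom nabla3 th /\
      independent_at nabla1 nabla2 nabla3 th.
Proof.
  split; [exact nabla1_invariant|].
  split; [exact nabla2_invariant|].
  split; [exact nabla3_invariant|].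
  exists regular_jets; split; [exact zariski_open_regular_jets|].
  intros th [_ H].
  assert (H1 : W_v th <> 0) by (intros E; rewrite E in H; lra).
  assert (H2 : W_vv th <> 0) by (intros E; rewrite E in H; lra).
  split; [exact H2|split; [split; assumption|split; [exact H1|]]].
  now apply nabla_independent.
Qed.
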